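(* Let $V=\mathbb{R}^2(x,y)$ with symplectic form $\omega=dx\wedge dy$, and let the conformal symplectic group $H=\mathrm{CSp}(2,\mathbb{R})=\mathrm{Sp}(2,\mathbb{R})\times\mathbb{R}_+$ act linearly on $V$ (with $\mathbb{R}_+$ acting by homotheties) and trivially on the values $u$ of functions $u=u(x,y)$. Put $I_0=u$, $I_1=xu_x+yu_y$, $I_{2a}=x^2u_{xx}+2xyu_{xy}+y^2u_{yy}$, $I_{2b}=xu_yu_{xx}-yu_xu_{yy}+(yu_y-xu_x)u_{xy}$, $I_{2c}=u_x^2u_{yy}-2u_xu_yu_{xy}+u_y^2u_{xx}$, and $$I'_{2b}=I_{2b}^{-2}I_{2c},\qquad \nabla_1=x\mathcal{D}_x+y\mathcal{D}_y,\qquad \nabla'_2=I_{2b}^{-1}(u_x\mathcal{D}_y-u_y\mathcal{D}_x),$$ (where $I_1=\nabla_1(I_0)$ and $I_{2a}=\nabla_1(I_1)-I_1$). Then the algebra of differential invariants of the $H$-action on the space $J^\infty(V)$ of infinite jets of functions on $V$ is $$\mathcal{A}_H=\langle I_0,I'_{2b}\,;\,\nabla_1,\nabla'_2\ |\ \mathcal{R}_1,\mathcal{R}_2,\mathcal{R}_3,\mathcal{R}_4\rangle,$$ where $\mathcal{R}_1$: $\nabla'_2(I_0)=0$; $\mathcal{R}_2$: $\nabla'_2(I_1)=-1$; $\mathcal{R}_3$: $[\nabla_1,\nabla'_2]=\frac1{I_1}\nabla_1+\bigl(\frac{I_{2a}}{I_1}+\nabla'_2(I_{2a})\bigr)\nabla'_2$;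 and, with $I_{3a}=\nabla_1(I_{2a})$, $I_{3b}=\nabla'_2(I_{2a})$, $I_{3c}=\nabla_1(I'_{2b})$, $\mathcal{R}_4$ is the relation $$\begin{aligned}&\nabla_2'(I_{3a})+\frac{1}{2I'_{2b}}\nabla_2'(I_{3b})-\frac{1}{2I'_{2b}}\nabla_1(I_{3c})-\frac{1}{2I_1^2I'_{2b}}\Bigl[(I'_{2b}I_{3b}-3I_{3b}I_{3c}-I_{3c})I_1^2\\&+\bigl(\bigl((3I_{3b}+4)I_{2a}-5I_{3a}\bigr)I'_{2b}-4I_{2a}I_{3c}-4I_{3b}-4\bigr)I_1+6I_{2a}^2I'_{2b}-6I_{2a}\Bigr]=0.\end{aligned}$$
   Context: $J^k(V)$ is the space of $k$-jets of functions $u=u(x,y)$, with coordinates $x,y,u$ and the partial derivatives of $u$ up to order $k$; $\mathcal{D}_x,\mathcal{D}_y$ are the total derivatives. $H$ acts on $J^k(V)$ by prolongation. A differential invariant of order $k$ is a function on $J^k(V)$ constant on orbits of the prolonged action; differential invariants are taken to be rational functions of the jet-variables (and may be chosen polynomial in jet-variables of sufficiently high order). $\mathcal{A}_H$ is the algebra of all differential invariants. An invariant derivation is a combination of total derivatives, with coefficients functions on a finite jet space, commuting with the prolonged action. $\langle I_i;\nabla_j\mid\mathcal{R}_l\rangle$ means: every element of the algebra is a rational expression in finitely many functions $\nabla_JI_i$ ($\nabla_J$ iterated compositions of the derivations), and all relations among these (differential syzygies, including commutator relations) are consequences, algebraic and by applying the derivations, of the relations $\mathcal{R}_l$. *)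

(* Defs.v *)
From HB Require Import structures.
From mathcomp Require Import all_boot all_order all_algebra.
From mathcomp Require Import finmap.
From mathcomp Require Import reals.
From mathcomp Require Import (canonicals, coercions) mpoly.
From mathcomp Require Import monalg.

Set Implicit Arguments.
Unset Strict Implicit.
Unset Printing Implicit Defensive.

Import Order.TTheory GRing.Theory Num.Theory.
Local Open Scope ring_scope.
Local Open Scope quotient_scope.

(* Polynomials in possibly infinitely many indeterminates indexed by I.
   monalg provides the commutative algebra structure; the field of fractions
   also needs the integral domain structure, which is obtained below by
   embedding finitely many elements in a ring {mpoly R[n]}. *)
Definition ipoly (R : idomainType) (I : choiceType) := {malg R[{cmonom I}]}.

Section IpolyDomain.
Variables (R : idomainType) (I : choiceType).

HB.instance Definition _ := GRing.ComAlgebra.on (ipoly R I).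

Implicit Types (p q : ipoly R I) (m : {cmonom I}) (s : seq I).

Definition trunc s m : mpoly.multinom (size s) :=
  mpoly.Multinom [tuple m (tnth (in_tuple s) i) | i < size s].

Definition embed s m : mpoly.mpoly (size s) R :=
  mpoly.mpolyX R (trunc s m).

Fact embed_mmorphism s :
  @mmorphism {cmonom I} (mpoly.mpoly (size s) R) (embed s).
Proof.
split=> [m1 m2|]; rewrite /embed.
  rewrite -mpoly.mpolyXD; congr mpoly.mpolyX; apply/mpoly.mnmP=> i.
  by rewrite mpoly.mnmDE !mpoly.mnmE cmM.
rewrite -mpoly.mpolyX0; congr mpoly.mpolyX; apply/mpoly.mnmP=> i.
by rewrite mpoly.mnm0E mpoly.mnmE cm1.
Qed.

HB.instance Definition _ s :=
  isMultiplicative.Build {cmonom I} (mpoly.mpoly (size s) R) (embed s)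
    (embed_mmorphism s).

Definition vars p : seq I := flatten [seq finsupp m : seq I | m <- msupp p].

Lemma mem_vars p m i : m \in msupp p -> m i != 0%N -> i \in vars p.
Proof.
move=> mp mi; apply/flattenP; exists (finsupp m : seq I).
  by apply/mapP; exists m.
by rewrite -cmE_neq0.
Qed.

Definition to_mpoly s p : mpoly.mpoly (size s) R :=
  mmap (@mpoly.mpolyC (size s) R) (embed s) p.

Lemma to_mpolyM s p q : to_mpoly s (p * q) = to_mpoly s p * to_mpoly s q.
Proof. by rewrite /to_mpoly rmorphM. Qed.

Lemma coeff_to_mpoly s p m : {subset vars p <= s} -> m \in msupp p ->
  mpoly.mcoeff (trunc s m) (to_mpoly s p) = p@_m.
Proof.
move=> ps mp; rewrite /to_mpoly mmapE raddf_sum /=.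
rewrite (bigD1_seq m) //= ?fset_uniq //.
rewrite mpoly.mcoeffCM mpoly.mcoeffX eqxx mulr1 big_seq_cond big1 ?addr0 //.
move=> m' /andP[m'p m'm]; rewrite mpoly.mcoeffCM mpoly.mcoeffX.
case: eqP => [e|_]; last by rewrite mulr0.
case/negP: m'm; apply/cmP => i.
have [is_|nis] := boolP (i \in s).
  have ilt : (index i s < size s)%N by rewrite index_mem.
  move/mpoly.mnmP/(_ (Ordinal ilt)): e; rewrite !mpoly.mnmE.
  by rewrite !(tnth_nth i) /= nth_index.
have nv : i \notin vars p by apply: contra nis => /ps.
have z m0 : m0 \in msupp p -> m0 i = 0%N.
  by move=> m0p; apply/eqP; apply: contraNT nv; apply: mem_vars.
by rewrite !z.
Qed.

Lemma to_mpoly_eq0 s p : {subset vars p <= s} -> to_mpoly s p = 0 -> p = 0.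
Proof.
move=> ps p0; apply/malgP => m; rewrite mcoeff0.
have [mp|] := boolP (m \in msupp p); last exact: mcoeff_outdom.
by rewrite -(coeff_to_mpoly ps mp) p0 mpoly.mcoeff0.
Qed.

Definition ipoly_unit : pred (ipoly R I) :=
  fun p => (p == (p@_(mone : {cmonom I}))%:MP)
           && (p@_(mone : {cmonom I}) \in GRing.unit).

Definition ipoly_inv p : ipoly R I :=
  if ipoly_unit p then ((p@_(mone : {cmonom I}))^-1)%:MP else p.

Fact ipoly_mulVp : {in ipoly_unit, left_inverse 1 ipoly_inv *%R}.
Proof.
move=> p pu; rewrite /ipoly_inv; move: (pu); rewrite -topredE /= => pu'.
rewrite pu'; case/andP: pu' => /eqP {3}-> u.
by rewrite -mpolyCM mulVr // mpolyC1E.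
Qed.

Fact ipoly_intro_unit p q : q * p = 1 -> ipoly_unit p.
Proof.
move=> qp1.
have pC : p == (p@_(mone : {cmonom I}))%:MP.
  pose s := vars p.
  have : to_mpoly s q * to_mpoly s p = 1.
    by rewrite -to_mpolyM qp1 /to_mpoly rmorph1.
  move/mpoly.mpoly_intro_unit => /andP[/eqP e _].
  apply/eqP/malgP => m; rewrite mcoeffC.
  have [->|m1] := eqVneq m mone; first by rewrite mulr1n.
  rewrite mulr0n; apply: contraNeq m1; rewrite mcoeff_neq0 => mp.
  have := coeff_to_mpoly (s := s) (fun _ => id) mp.
  rewrite e mpoly.mcoeffC; case: eqP => [t0 _|_].
    apply/cmP => i; apply/eqP; rewrite cm1; apply: contraT => mi.
    have is_ := mem_vars mp mi.
    have ilt : (index i s < size s)%N by rewrite index_mem.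
    move/mpoly.mnmP/(_ (Ordinal ilt)): t0.
    rewrite mpoly.mnm0E mpoly.mnmE (tnth_nth i) /= nth_index // => mi0.
    by rewrite mi0 in mi.
  by rewrite mulr0 => /esym/eqP; rewrite mcoeff_eq0 mp.
rewrite /ipoly_unit pC /=; apply/unitrP; exists (q@_(mone : {cmonom I})).
have e : (q@_(mone : {cmonom I})) * (p@_(mone : {cmonom I})) = 1 :> R.
  by rewrite -rmorphM /= qp1 rmorph1.
by split=> //; rewrite mulrC.
Qed.

Fact ipoly_inv_out : {in [predC ipoly_unit], ipoly_inv =1 id}.
Proof. by move=> p pu; rewrite /ipoly_inv ifN. Qed.

HB.instance Definition _ :=
  GRing.ComNzRing_hasMulInverse.Build (ipoly R I)
    ipoly_mulVp ipoly_intro_unit ipoly_inv_out.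

Fact ipoly_idomainAxiom p q : p * q = 0 -> (p == 0) || (q == 0).
Proof.
move=> pq0; pose s := vars p ++ vars q.
have : to_mpoly s p * to_mpoly s q = 0.
  by rewrite -to_mpolyM pq0 /to_mpoly raddf0.
move/eqP; rewrite mulf_eq0 => /orP[]/eqP.
  by move/to_mpoly_eq0 => -> //; [rewrite eqxx | move=> i; rewrite mem_cat => ->].
move/to_mpoly_eq0 => ->; first by rewrite eqxx orbT.
by move=> i; rewrite mem_cat orbC => ->.
Qed.

HB.instance Definition _ :=
  GRing.ComUnitRing_isIntegral.Build (ipoly R I) ipoly_idomainAxiom.

End IpolyDomain.

Notation "x %:F" := (@FracField.tofrac _ x) : ring_scope.

Section RationalFunctions.
Variables (R : idomainType) (I : choiceType).

Local Notation P := (ipoly R I).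
Local Notation K := {fraction P}.

Definition var (i : I) : P := << ucm i >>.

Definition monom_eval (A : comNzRingType) (v : I -> A) (m : {cmonom I}) : A :=
  \prod_(i <- finsupp m) v i ^+ m i.

(* iota is the map R -> A applied to the coefficients *)
Definition poly_eval (A : comNzRingType) (iota : R -> A) (v : I -> A) (p : P)
    : A :=
  mmap iota (monom_eval v) p.

(* The chosen numerator and denominator \n_(repr f), \d_(repr f) are arbitrary;
   the result is the substitution v whenever the denominators of f do not
   vanish under v. *)
Definition frac_eval (A : fieldType) (iota : R -> A) (v : I -> A) (f : K) : A :=
  poly_eval iota v \n_(repr f) / poly_eval iota v \d_(repr f).

(* the R-linear derivation of P that maps each indeterminate i to v i *)
Definition poly_der (v : I -> P) (p : P) : P :=
  \sum_(m <- msupp p) \sum_(i <- finsupp m)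
    (<< p@_m *+ m i *g divcm m (ucm i) >> : P) * v i.

Definition frac_der (v : I -> P) (f : K) : K :=
  let n := \n_(repr f) in let d := \d_(repr f) in
  (poly_der v n * d - n * poly_der v d)%:F / (d ^+ 2)%:F.

End RationalFunctions.

Arguments var R {I} i.

(* Coordinates on J^oo(V): Ju i j is the derivative u_{x^i y^j}. *)
Inductive jetvar : Type := Jx | Jy | Ju of nat & nat.

Definition jetvar_code (v : jetvar) : bool + nat * nat :=
  match v with Jx => inl true | Jy => inl false | Ju i j => inr (i, j) end.

Definition jetvar_decode (c : bool + nat * nat) : jetvar :=
  match c with
  | inl true => Jx | inl false => Jy | inr ij => Ju ij.1 ij.2
  end.

Lemma jetvar_codeK : cancel jetvar_code jetvar_decode.
Proof. by case. Qed.

HB.instance Definition _ := Countable.copy jetvar (can_type jetvar_codeK).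

Notation jetpoly R := (ipoly R jetvar).
Notation jetfield R := {fraction ipoly R jetvar}.

Section Jets.
Variable R : realType.

Local Notation jetpoly := (jetpoly R).
Local Notation jetfield := (jetfield R).

Definition jet_const (c : R) : jetfield := (c%:MP : jetpoly)%:F.

Definition jvar (v : jetvar) : jetfield := (var R v)%:F.

Definition total_x (v : jetvar) : jetpoly :=
  match v with Jx => 1 | Jy => 0 | Ju i j => var R (Ju i.+1 j) end.

Definition total_y (v : jetvar) : jetpoly :=
  match v with Jx => 0 | Jy => 1 | Ju i j => var R (Ju i j.+1) end.

Definition Dx : jetfield -> jetfield := frac_der total_x.
Definition Dy : jetfield -> jetfield := frac_der total_y.

Definition omega (v w : 'cV[R]_2) : R :=
  v 0 0 * w 1 0 - v 1 0 * w 0 0.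

Definition Sp2 (A : 'M[R]_2) : Prop :=
  forall v w : 'cV[R]_2, omega (A *m v) (A *m w) = omega v w.

Definition CSp2 (g : 'M[R]_2) : Prop :=
  exists (A : 'M[R]_2) (t : R), [/\ Sp2 A, 0 < t & g = t *: A].

(* The coordinate v of the prolonged transformation g . th, as a polynomial in
   the coordinates of th. With h = g^-1, the prolongation of
   (X, u) |-> (g X, u) sends u_{x^i y^j} to D1^i D2^j u, where
   D1 = h_00 D_x + h_10 D_y and D2 = h_01 D_x + h_11 D_y: these are the partial
   derivatives of u o h at g X. *)
Definition prolong (g : 'M[R]_2) (v : jetvar) : jetpoly :=
  let h := invmx g in
  let D (k : 'I_2) (p : jetpoly) : jetpoly :=
    h 0 k *: poly_der total_x p + h 1 k *: poly_der total_y p in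
  match v with
  | Jx => g 0 0 *: var R Jx + g 0 1 *: var R Jy
  | Jy => g 1 0 *: var R Jx + g 1 1 *: var R Jy
  | Ju i j => iter i (D 0) (iter j (D 1) (var R (Ju 0 0)))
  end.

(* f is defined at the jet th, with value c *)
Definition has_value (f : jetfield) (th : jetvar -> R) (c : R) : Prop :=
  exists p q : jetpoly, [/\ f = p%:F / q%:F, poly_eval idfun th q != 0
                          & c = poly_eval idfun th p / poly_eval idfun th q].

Definition jet_act (g : 'M[R]_2) (th : jetvar -> R) : jetvar -> R :=
  fun v => poly_eval idfun th (prolong g v).

(* f |-> f o g *)
Definition pullback (g : 'M[R]_2) : jetfield -> jetfield :=
  frac_eval jet_const (fun v => (prolong g v)%:F).

(* f is constant on the orbits, where it is defined. It involves finitely many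
   jet variables, so it is a function on some J^k(V). *)
Definition differential_invariant (f : jetfield) : Prop :=
  forall (g : 'M[R]_2) (th : jetvar -> R) (c c' : R), CSp2 g ->
    has_value f th c -> has_value f (jet_act g th) c' -> c' = c.

Definition invariant_derivation (nabla : jetfield -> jetfield) : Prop :=
  (exists a b : jetfield, forall f, nabla f = a * Dx f + b * Dy f) /\
  (forall g, CSp2 g -> forall f, nabla (pullback g f) = pullback g (nabla f)).

Local Notation x := (jvar Jx).
Local Notation y := (jvar Jy).
Local Notation u_x := (jvar (Ju 1 0)).
Local Notation u_y := (jvar (Ju 0 1)).
Local Notation u_xx := (jvar (Ju 2 0)).
Local Notation u_xy := (jvar (Ju 1 1)).
Local Notation u_yy := (jvar (Ju 0 2)).

Definition I0 : jetfield := jvar (Ju 0 0).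
Definition I1 : jetfield := x * u_x + y * u_y.
Definition I2a : jetfield := x ^+ 2 * u_xx + 2 * x * y * u_xy + y ^+ 2 * u_yy.
Definition I2b : jetfield :=
  x * u_y * u_xx - y * u_x * u_yy + (y * u_y - x * u_x) * u_xy.
Definition I2c : jetfield :=
  u_x ^+ 2 * u_yy - 2 * u_x * u_y * u_xy + u_y ^+ 2 * u_xx.
Definition I2b' : jetfield := I2b ^- 2 * I2c.

Definition nabla1 (f : jetfield) : jetfield := x * Dx f + y * Dy f.
Definition nabla2' (f : jetfield) : jetfield :=
  I2b^-1 * (u_x * Dy f - u_y * Dx f).

End Jets.

Notation dpoly R G D := (ipoly R (G * seq D)%type).
Notation dfrac R G D := {fraction ipoly R (G * seq D)%type}.

Section Presentation.
Variables (R : idomainType) (G D : choiceType).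

(* The free differential algebra: the indeterminate (i, [:: j1; ...; jk])
   stands for nabla_j1 (... (nabla_jk I_i)); no commutation is imposed. *)
Local Notation dpoly := (dpoly R G D).
Local Notation dfrac := (dfrac R G D).

Definition formal_gen (i : G) : dfrac := (var R (i, [::] : seq D))%:F.

Definition formal_der (j : D) : dfrac -> dfrac :=
  frac_der (fun iw : G * seq D => var R (iw.1, j :: iw.2)).

Definition localization (dens : seq dfrac) (a : dfrac) : Prop :=
  exists (p : dpoly) (s : seq dfrac),
    {subset s <= dens} /\ a = p%:F / \prod_(d <- s) d.

(* The differential ideal generated by the relators in the ring of differential
   polynomials with dens inverted. *)
Inductive consequence (dens : seq dfrac) (relator : dfrac -> Prop)
    : dfrac -> Prop :=
| conseq_relator r : relator r -> consequence dens relator r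
| conseq_add r r' : consequence dens relator r -> consequence dens relator r' ->
    consequence dens relator (r + r')
| conseq_mul a r : localization dens a -> consequence dens relator r ->
    consequence dens relator (a * r)
| conseq_der j r : consequence dens relator r ->
    consequence dens relator (formal_der j r).

Variables (K : fieldType) (iota : R -> K).
Variables (gens : G -> K) (ders : D -> K -> K).

Definition dpoly_eval : dpoly -> K :=
  poly_eval iota (fun iw : G * seq D => foldr ders (gens iw.1) iw.2).

(* A = < gens ; ders | relator >: the elements of A are the rational expressions
   in the iterated derivatives of gens, and every polynomial relation between
   these iterated derivatives is a consequence of the relators. *)
Definition presented (A : K -> Prop) (dens : seq dfrac)
    (relator : dfrac -> Prop) : Prop :=
  (forall f, A f <-> exists p q : dpoly,
     dpoly_eval q != 0 /\ f = dpoly_eval p / dpoly_eval q) /\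
  (forall p : dpoly, dpoly_eval p = 0 <-> consequence dens relator p%:F).

End Presentation.

(* The relations, each as (left-hand side) - (right-hand side), in a field F
   with operators d1, d2 and elements i0, i2b; they are used both for the jet
   functions and for the formal symbols. *)
Section Relations.
Variables (F : fieldType) (d1 d2 : F -> F) (i0 i2b : F).

Let i1 := d1 i0.
Let i2a := d1 i1 - i1.
Let i3a := d1 i2a.
Let i3b := d2 i2a.
Let i3c := d1 i2b.

Definition rel1 : F := d2 i0.

Definition rel2 : F := d2 i1 - (- 1).

(* the operator identity, applied to f *)
Definition rel3 (f : F) : F :=
  (d1 (d2 f) - d2 (d1 f))
  - (1 / i1 * d1 f + (i2a / i1 + d2 i2a) * d2 f).

Definition rel4 : F :=
  d2 i3a + 1 / (2 * i2b) * d2 i3b - 1 / (2 * i2b) * d1 i3c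
  - 1 / (2 * i1 ^+ 2 * i2b) *
    ((i2b * i3b - 3 * i3b * i3c - i3c) * i1 ^+ 2
     + (((3 * i3b + 4) * i2a - 5 * i3a) * i2b
        - 4 * i2a * i3c - 4 * i3b - 4) * i1
     + 6 * i2a ^+ 2 * i2b - 6 * i2a).

End Relations.

Definition pair_fun (T : Type) (a b : T) : bool -> T :=
  fun k => if k then b else a.

Section FormalRelations.
Variable R : realType.

Local Notation L := (dfrac R bool bool).

Local Notation d1 := (@formal_der R bool bool false).
Local Notation d2 := (@formal_der R bool bool true).
Local Notation Y0 := (@formal_gen R bool bool false).
Local Notation Y2b := (@formal_gen R bool bool true).

(* the denominators that occur in the relations: the symbols of I_1, I'_2b *)
Definition H_dens : seq L := [:: d1 Y0; Y2b].

Inductive H_relator : L -> Prop :=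
| H_rel1 : H_relator (rel1 d2 Y0)
| H_rel2 : H_relator (rel2 d1 d2 Y0)
| H_rel3 f : localization H_dens f -> H_relator (rel3 d1 d2 Y0 f)
| H_rel4 : H_relator (rel4 d1 d2 Y0 Y2b).

End FormalRelations.

(* Main.v *)
Require Import Defs.
From mathcomp Require Import all_boot all_algebra reals.
From HB Require Import structures.
From mathcomp Require Import all_order finmap boolp ring.
From mathcomp Require Import monalg.

Set Implicit Arguments.
Unset Strict Implicit.
Unset Printing Implicit Defensive.

Import Order.TTheory GRing.Theory Num.Theory.
Local Open Scope ring_scope.
Local Open Scope quotient_scope.

(** Let v = (x, y) and let w be I_2b^-1 times the Hamiltonian vector of u. Both
    are equivariant, so that the derivatives J_ij of u along v (i times) and w
    (j times) are invariants: they are the coordinates of the jet moved to the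
    section x = 1, y = 0, u_y = 0, u_xy = -1, and nabla_1, nabla_2 are the
    derivations along v and w. An invariant is therefore a rational function
    of the J_ij; since GL2+ only reaches the jets whose frame (v, w) is
    positively oriented, a Zariski density argument is needed.

    Write nabla_1 v = v, nabla_2 v = w, nabla_1 w = al v + be w and
    nabla_2 w = ga v + de w. The four coefficients are read off by
    differentiating J_01 = 0 and J_11 = -1. Differentiating the other J_ij
    expresses them recursively by iterated derivatives of I_0 = J_00 and
    I'_2b = J_02. The same recursion makes sense for formal symbols, and R_1,
    R_2, R_3 together with the flatness of this connection imply both
    structure equations for the formal J_ij; given R_1, R_2 and R_3, flatness
    amounts to R_4. Hence each formal differential polynomial is equal, modulo
    consequences of the relations, to a polynomial in the J_ij divided by a
    power of I_1. As the J_ij other than J_01 and J_11 are algebraically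
    independent (restrict to the section), the polynomial obtained from a
    relation vanishes at the formal J_ij. *)

(** * Polynomials in infinitely many variables and their fractions *)

(** A rational function can be evaluated only where the denominator of some representation survives,
    whereas [frac_eval] uses an arbitrary representation. Passages between fields therefore go
    through a relation, [value], which is single-valued and compatible with field operations and
    derivations. Its instances are evaluation at a real jet, pullback by a group element,
    restriction to the section, and evaluation of formal symbols at jet functions.

    R_4 is an integrability condition. The formal J_ij are defined by solving the nabla_2 equations,
    which thus hold by construction up to R_1 and R_2. The nabla_1 equations must be deduced column
    by column, by exchanging nabla_1 and nabla_2, and the obstruction is the curvature of the frame
    connection. One of its two coefficients is a multiple of R_2; the other is -2 I'_2b R_4 plus
    multiples of R_2 and R_3.

    Written in the J_ij, the connection coefficients have no denominator but I_1, so normal forms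
    contain no inverse of I'_2b although R_4 does. *)

Section Monomials.
Variable I : choiceType.
Implicit Types (m : {cmonom I}) (i : I).

Lemma divcmK m i : m i != 0%N -> mmul (ucm i) (divcm m (ucm i)) = m.
Proof.
move=> mi; apply/eqP/cmP => j; rewrite cmM divcmE cmU.
by case: eqVneq => [<-|_]; rewrite ?subn0 // add1n subn1 prednK // lt0n.
Qed.

Lemma mulcm_div m1 m2 i : m2 i != 0%N ->
  mmul m1 (divcm m2 (ucm i)) = divcm (mmul m1 m2) (ucm i).
Proof.
move=> mi; apply/eqP/cmP => j; rewrite !(divcmE, cmM) cmU.
by case: eqVneq => [<-|_]; rewrite ?subn0 // addnBA // lt0n.
Qed.

Lemma cmonom_ind (P : {cmonom I} -> Prop) :
  P mone -> (forall i m, P m -> P (mmul (ucm i) m)) -> forall m, P m.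
Proof.
move=> P1 PM m; have [n] := ubnP (mdeg m); elim: n m => // n IHn m lt_mn.
have [->//|m1] := eqVneq m mone.
have [i mi] : exists i, m i != 0%N.
  apply: contrapT => no; case/negP: m1; apply/cmP => i; rewrite cm1.
  by apply: contrapT => /eqP mi; apply: no; exists i.
rewrite -(divcmK mi); apply/PM/IHn; rewrite -ltnS.
by apply: leq_trans lt_mn; rewrite -{2}(divcmK mi) mdegM mdegU add1n.
Qed.

End Monomials.

Section PolyEval.
Variables (R : idomainType) (I : choiceType).
Local Notation P := (ipoly R I).
Implicit Types (p q : P) (m : {cmonom I}).

Lemma ipoly_lin_ind (T : P -> Prop) :
  T 0 -> (forall p q, T p -> T q -> T (p + q)) ->
  (forall c m, T << c *g m >>) -> forall p, T p.
Proof.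
move=> T0 TD TU p; rewrite (monalgE p).
by elim: (msupp p : seq _) => [|m s IHs]; rewrite ?big_nil ?big_cons //; apply: TD.
Qed.

Lemma mulUU c d m m' :
  (<< c *g m >> : P) * << d *g m' >> = << c * d *g mmul m m' >>.
Proof. by rewrite malgM_def /= fgmulUU. Qed.

Lemma monomM m m' : (<< m >> : P) * << m' >> = << mmul m m' >>.
Proof. by rewrite mulUU mulr1. Qed.

Lemma ipoly_ind (T : P -> Prop) :
  (forall c, T c%:MP) -> (forall i, T (var R i)) ->
  (forall p q, T p -> T q -> T (p + q)) ->
  (forall p q, T p -> T q -> T (p * q)) -> forall p, T p.
Proof.
move=> TC TX TD TM; apply: ipoly_lin_ind => [|//|c m].
  by rewrite -malgC0E; apply: TC.
rewrite -[c]mulr1 -[m]mul1m -mulUU; apply: (TM) => //.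
elim/cmonom_ind: m => [|i m IHm]; first exact: TC.
have -> : << mmul (ucm i) m >> = var R i * << m >> by rewrite mulUU mulr1.
exact: TM (TX i) IHm.
Qed.

Section Eval.
Variables (A : comNzRingType) (iota : {rmorphism R -> A}) (v : I -> A).

Lemma monom_evalEw (d : {fset I}) m : (finsupp m `<=` d)%fset ->
  monom_eval v m = \prod_(i <- d) v i ^+ m i.
Proof.
move=> le; rewrite /monom_eval (big_fset_incl _ le) // => i _.
by rewrite -cmE_eq0 => /eqP->.
Qed.

Fact monom_eval_mmorphism : mmorphism (monom_eval v).
Proof.
split=> [m1 m2|]; last by rewrite /monom_eval mdom1 big_seq_fset0.
have le: (finsupp (mmul m1 m2) `<=` finsupp m1 `|` finsupp m2)%fset.
  by rewrite mdomD.
rewrite (monom_evalEw le) !(@monom_evalEw (finsupp m1 `|` finsupp m2)%fset);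
  rewrite ?fsubsetUl ?fsubsetUr //.
by rewrite -big_split; apply: eq_bigr => i _; rewrite cmM exprD.
Qed.

HB.instance Definition _ :=
  isMultiplicative.Build {cmonom I} A (monom_eval v) monom_eval_mmorphism.

Fact poly_eval_zmod : zmod_morphism (poly_eval iota v).
Proof. by move=> p q; rewrite /poly_eval raddfB. Qed.

Fact poly_eval_monoid : monoid_morphism (poly_eval iota v).
Proof.
split=> [|p q]; first exact: mmap1.
exact: (mmap_is_multiplicative (f := iota) (h := monom_eval v)).1.
Qed.

HB.instance Definition _ :=
  GRing.isZmodMorphism.Build P A (poly_eval iota v) poly_eval_zmod.
HB.instance Definition _ :=
  GRing.isMonoidMorphism.Build P A (poly_eval iota v) poly_eval_monoid.

Lemma poly_evalC c : poly_eval iota v c%:MP = iota c.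
Proof. by rewrite /poly_eval mmapC. Qed.

Lemma poly_evalX i : poly_eval iota v (var R i) = v i.
Proof.
rewrite /poly_eval mmapU /= rmorph1 mul1r /monom_eval mdomU.
by rewrite big_seq_fset1 cmUU expr1.
Qed.

End Eval.

Lemma poly_eval_comp (A B : comNzRingType) (iota : {rmorphism R -> A})
    (iota' : {rmorphism R -> B}) (h : {rmorphism A -> B}) (v : I -> A) p :
  (forall c, h (iota c) = iota' c) ->
  h (poly_eval iota v p) = poly_eval iota' (fun i => h (v i)) p.
Proof.
move=> hc; elim/ipoly_ind: p => [c|i|p q IHp IHq|p q IHp IHq].
- by rewrite !poly_evalC.
- by rewrite !poly_evalX.
- by rewrite !rmorphD /= IHp IHq.
- by rewrite !rmorphM /= IHp IHq.
Qed.

Lemma poly_eval_ext (A : comNzRingType) (iota : {rmorphism R -> A})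
    (v w : I -> A) p :
  v =1 w -> poly_eval iota v p = poly_eval iota w p.
Proof. by move=> vw; congr poly_eval; apply: funext. Qed.

End PolyEval.

(** * Derivations and their extension to polynomials and fractions *)

Record derivation (F : pzRingType) (d : F -> F) : Prop := Derivation {
  derD : {morph d : f g / f + g};
  derM : forall f g, d (f * g) = d f * g + f * d g
}.

Section DerivationTheory.
Variables (F : fieldType) (d : F -> F) (dP : derivation d).

Lemma der0 : d 0 = 0.
Proof. by apply: (@addrI _ (d 0)); rewrite -(derD dP) !addr0. Qed.

Lemma derN : {morph d : f / - f}.
Proof. by move=> f; apply/eqP; rewrite -subr_eq0 opprK -(derD dP) addNr der0. Qed.

Lemma derB : {morph d : f g / f - g}.
Proof. by move=> f g; rewrite (derD dP) derN. Qed.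

Lemma der1 : d 1 = 0.
Proof.
by apply: (@addrI _ (d 1)); rewrite addr0 -{3}[1]mulr1 (derM dP) mulr1 mul1r.
Qed.

Lemma derMn n : {morph d : f / f *+ n}.
Proof. by move=> f; elim: n => [|n IH]; rewrite ?der0 // !mulrS (derD dP) IH. Qed.

Lemma der_nat n : d n%:R = 0.
Proof. by rewrite derMn der1 mul0rn. Qed.

Lemma derV f : d f^-1 = - (d f / f ^+ 2).
Proof.
have [->|f0] := eqVneq f 0; first by rewrite invr0 der0 mul0r oppr0.
have : d (f * f^-1) = 0 by rewrite mulfV // der1.
rewrite (derM dP) => /eqP; rewrite addrC addr_eq0 => /eqP e.
apply: (mulfI f0); rewrite e; field; exact: f0.
Qed.

End DerivationTheory.

(** The premises are multiplied by [k1] and [k2] because the factorisations of monomials through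
    [divcm] hold only at nonzero exponents: [divcm] truncates at 0. *)
Fact leibniz_term (P : comPzRingType) (a b c m1 m2 t : P) (k1 k2 : nat) :
  c *+ k1 = (a * m2) *+ k1 -> c *+ k2 = (m1 * b) *+ k2 ->
  (c *+ (k1 + k2)) * t = (a *+ k1) * t * m2 + m1 * ((b *+ k2) * t).
Proof.
move=> e1 e2; rewrite mulrnDr e1 e2 mulrDl; congr (_ + _).
  by rewrite -mulrnAl mulrAC.
by rewrite -mulrnAr mulrA.
Qed.

Fact leibniz_monomials (P : comPzRingType) (d : P -> P)
    (x y z a b ab m m' dm dm' dmm' : P) :
  x = a * m -> y = b * m' -> x * y = z ->
  d x = a * dm -> d y = b * dm' -> d z = ab * dmm' -> ab = a * b ->
  dmm' = dm * m' + m * dm' -> d (x * y) = d x * y + x * d y.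
Proof. by move=> ex ey -> -> -> -> -> ->; rewrite ex ey; ring. Qed.

Section Leibniz.
Variables (P : pzRingType) (d : P -> P) (dD : {morph d : f g / f + g}).
Implicit Types f g : P.

Let d0 : d 0 = 0.
Proof. by apply: (@addrI _ (d 0)); rewrite -dD !addr0. Qed.

Fact leibniz0l g : d (0 * g) = d 0 * g + 0 * d g.
Proof. by rewrite !mul0r d0 mul0r addr0. Qed.

Fact leibniz0r f : d (f * 0) = d f * 0 + f * d 0.
Proof. by rewrite !mulr0 d0 mulr0 addr0. Qed.

Fact leibnizDl f f' g : d (f * g) = d f * g + f * d g ->
  d (f' * g) = d f' * g + f' * d g ->
  d ((f + f') * g) = d (f + f') * g + (f + f') * d g.
Proof. by move=> e e'; rewrite mulrDl !dD e e' !mulrDl addrACA. Qed.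

Fact leibnizDr f g g' : d (f * g) = d f * g + f * d g ->
  d (f * g') = d f * g' + f * d g' ->
  d (f * (g + g')) = d f * (g + g') + f * d (g + g').
Proof. by move=> e e'; rewrite mulrDr !dD e e' !mulrDr addrACA. Qed.

End Leibniz.

Section PolyDer.
Variables (R : idomainType) (I : choiceType).
Local Notation P := (ipoly R I).
Local Notation K := {fraction P}.
Variable v : I -> P.
Implicit Types (p q : P) (m : {cmonom I}).

Definition monom_der m : P := \sum_(i <- finsupp m) (<< divcm m (ucm i) >> *+ m i) * v i.

Lemma monom_derEw (d : {fset I}) m : (finsupp m `<=` d)%fset ->
  monom_der m = \sum_(i <- d) (<< divcm m (ucm i) >> *+ m i) * v i.
Proof.
move=> le; rewrite /monom_der (big_fset_incl _ le) // => i _.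
by rewrite -cmE_eq0 => /eqP->; rewrite mulr0n mul0r.
Qed.

Lemma monom_derM m1 m2 : monom_der (mmul m1 m2) =
  monom_der m1 * << m2 >> + << m1 >> * monom_der m2.
Proof.
have le: (finsupp (mmul m1 m2) `<=` finsupp m1 `|` finsupp m2)%fset.
  by rewrite mdomD.
rewrite (monom_derEw le) !(@monom_derEw (finsupp m1 `|` finsupp m2)%fset);
  rewrite ?fsubsetUl ?fsubsetUr //.
rewrite mulr_suml [X in _ + X]mulr_sumr -big_split; apply: eq_bigr => i _ /=.
rewrite cmM; apply: leibniz_term.
  have [->|m1i] := eqVneq (m1 i) 0%N; first by rewrite !mulr0n.
  have <- : mmul (divcm m1 (ucm i)) m2 = divcm (mmul m1 m2) (ucm i).
    by rewrite mulmC mulcm_div // mulmC.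
  by rewrite monomM.
have [->|m2i] := eqVneq (m2 i) 0%N; first by rewrite !mulr0n.
by rewrite monomM mulcm_div.
Qed.

(** The defining sum runs over the support of [p], which hides additivity; as the linear extension
    of [monom_der] the map is visibly additive. *)
Lemma poly_derE p : poly_der v p = mmap (@malgC {cmonom I} R) monom_der p.
Proof.
rewrite /poly_der /mmap; apply: eq_bigr => m _; rewrite [RHS]mulr_sumr.
apply: eq_bigr => i _; rewrite [RHS]mulrA; congr (_ * _).
by rewrite [RHS]mulrnAr mulUU mul1m mulr1 -[RHS]monalgUMn.
Qed.

Lemma poly_derU c m : poly_der v << c *g m >> = c%:MP * monom_der m.
Proof. by rewrite poly_derE mmapU. Qed.

Lemma poly_derivation : derivation (poly_der v).
Proof.
have dD : {morph poly_der v : p q / p + q}.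
  by move=> p q; rewrite !poly_derE raddfD.
split=> // p q; elim/ipoly_lin_ind: p => [|p p' IHp IHp'|c m].
- exact: leibniz0l.
- exact: leibnizDl.
elim/ipoly_lin_ind: q => [|q q' IHq IHq'|c' m'].
- exact: leibniz0r.
- exact: leibnizDr.
have E (a : R) k : << a *g k >> = a%:MP * << k >> :> P.
  by rewrite mulUU mulr1 mul1m.
exact: (leibniz_monomials (E c m) (E c' m') (mulUU c c' m m') (poly_derU c m)
  (poly_derU c' m') (poly_derU _ _) (mpolyCM _ c c') (monom_derM m m')).
Qed.

Lemma poly_derC c : poly_der v c%:MP = 0.
Proof. by rewrite poly_derU /monom_der mdom1 big_seq_fset0 mulr0. Qed.

Lemma poly_derX i : poly_der v (var R i) = v i.
Proof.
rewrite poly_derU mul1r /monom_der mdomU big_seq_fset1 cmUU mulr1n.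
have -> : divcm (ucm i) (ucm i) = mone :> {cmonom I}.
  by apply/eqP/cmP => j; rewrite divcmE subnn cm1.
exact: mul1r.
Qed.

End PolyDer.

Section Fractions.
Variable (P : idomainType).
Local Notation K := {fraction P}.
Implicit Types (p q : P) (f : K).

Lemma num_den_repr f : f = (\n_(repr f))%:F / (\d_(repr f))%:F.
Proof.
have d0 : (\d_(repr f))%:F != 0 :> K by rewrite tofrac_eq0 denom_ratioP.
apply: (mulIf d0); rewrite divfK // -{1}[f]reprK.
unlock FracField.tofrac; rewrite -[LHS]FracField.pi_mul.
apply/eqmodP; rewrite /= /FracField.equivf /FracField.mulf /=.
by rewrite !numden_Ratio ?mulf_neq0 ?oner_eq0 ?denom_ratioP ?oner_neq0 // !mulr1 mulrC.
Qed.

Lemma frac_ind (T : K -> Prop) :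
  (forall p q, q != 0 -> T (p%:F / q%:F)) -> forall f, T f.
Proof. by move=> TF f; rewrite [f]num_den_repr; apply/TF/denom_ratioP. Qed.

Lemma frac_eq p q p' q' : q != 0 -> q' != 0 ->
  (p%:F / q%:F == p'%:F / q'%:F :> K) = (p * q' == p' * q).
Proof.
by move=> q0 q'0; rewrite eqr_div ?tofrac_eq0 // -!rmorphM /= tofrac_eq.
Qed.

End Fractions.

Section FractionDerivation.
Variables (P : idomainType) (d : P -> P) (dP : derivation d).
Local Notation K := {fraction P}.
Implicit Types (p q : P) (f : K).

Let D f : K :=
  let n := \n_(repr f) in let m := \d_(repr f) in
  (d n * m - n * d m)%:F / (m ^+ 2)%:F.

(** [D] is computed on the chosen representation [n / m]; independence of the choice follows by
    differentiating [p * m = n * q]. *)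
Fact fraction_derE p q : q != 0 ->
  D (p%:F / q%:F) = (d p * q - p * d q)%:F / (q ^+ 2)%:F.
Proof.
move=> q0; rewrite /D.
have := num_den_repr (p%:F / q%:F); have := denom_ratioP (repr (p%:F / q%:F : K)).
move: (\n_(repr _)) (\d_(repr _)) => n m m0 /eqP.
rewrite frac_eq // => /eqP e; apply/eqP; rewrite frac_eq ?expf_neq0 //.
have := congr1 d e; rewrite !(derM dP).
move: (d n) (d m) (d p) (d q) => n' m' p' q' e'; apply/eqP.
(* Regrouped so that only [p * m] and its derivative occur; both can then be replaced without
   dividing. *)
have -> : (p' * q - p * q') * m ^+ 2 =
  ((p' * m + p * m') * q - (p * m) * q') * m - (p * m) * q * m' by ring.
rewrite e' e; ring.
Qed.

Fact fraction_derivation : derivation D.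
Proof.
split; elim/frac_ind => p q q0; elim/frac_ind => p' q' q'0.
  have -> : p%:F / q%:F + p'%:F / q'%:F = (p * q' + p' * q)%:F / (q * q')%:F :> K.
    by rewrite addf_div ?tofrac_eq0 // !rmorphD !rmorphM.
  rewrite !fraction_derE ?mulf_neq0 // addf_div ?tofrac_eq0 ?expf_neq0 //.
  rewrite -!rmorphM -!rmorphD /=; apply/eqP.
  rewrite frac_eq ?mulf_neq0 ?expf_neq0 ?mulf_neq0 //; apply/eqP.
  rewrite (derD dP) !(derM dP).
  by move: (d p) (d q) (d p') (d q') => a b a' b'; ring.
rewrite mulf_div -!rmorphM /= !fraction_derE ?mulf_neq0 // !mulf_div -!rmorphM /=.
rewrite addf_div ?tofrac_eq0 ?mulf_neq0 ?expf_neq0 //.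
rewrite -!rmorphM -!rmorphD /=; apply/eqP.
rewrite frac_eq ?mulf_neq0 ?expf_neq0 ?mulf_neq0 //; apply/eqP.
rewrite !(derM dP).
by move: (d p) (d q) (d p') (d q') => a b a' b'; ring.
Qed.

Fact fraction_der_tofrac p : D p%:F = (d p)%:F.
Proof.
rewrite -[p%:F in LHS]divr1 -tofrac1 fraction_derE ?oner_neq0 //.
have -> : d 1 = 0.
  by apply: (@addrI _ (d 1)); rewrite addr0 -{3}[1]mulr1 (derM dP) mulr1 mul1r.
by rewrite mulr0 subr0 mulr1 expr1n tofrac1 divr1.
Qed.

End FractionDerivation.

Section FracDer.
Variables (R : idomainType) (I : choiceType) (v : I -> ipoly R I).

Lemma frac_derE p q : q != 0 -> frac_der v (p%:F / q%:F) =
  (poly_der v p * q - p * poly_der v q)%:F / (q ^+ 2)%:F.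
Proof. exact: fraction_derE (poly_derivation v) _ _. Qed.

Lemma frac_der_tofrac p : frac_der v p%:F = (poly_der v p)%:F.
Proof. exact: fraction_der_tofrac (poly_derivation v) _. Qed.

Lemma frac_derivation : derivation (frac_der v).
Proof. exact: fraction_derivation (poly_derivation v). Qed.

End FracDer.

(** * Partial evaluation of fractions *)

Section PartialEvaluation.
Variables (P : idomainType) (A : fieldType) (ev : {rmorphism P -> A}).
Local Notation K := {fraction P}.
Implicit Types (p q : P) (f g : K) (a b c : A).

(** Any representation with a surviving denominator may be used, so this is a partial function even
    where the representative picked by [repr] degenerates. [has_value] is the case where [ev] is
    evaluation at a real jet. *)
Definition value f c : Prop := exists p q : P,
  [/\ f = p%:F / q%:F, ev q != 0 & c = ev p / ev q].

Fact ev_neq0 q : ev q != 0 -> q != 0.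
Proof. by apply: contraNneq => ->; rewrite rmorph0. Qed.

Lemma value_uniq f c c' : value f c -> value f c' -> c = c'.
Proof.
move=> [p [q [-> q0 ->]]] [p' [q' [/eqP]]].
move=> + q'0 ->; rewrite frac_eq ?ev_neq0 // => /eqP e.
by apply/eqP; rewrite eqr_div // -!rmorphM e.
Qed.

Lemma value_tofrac p : value p%:F (ev p).
Proof.
by exists p, 1; rewrite !rmorph1 oner_neq0 !divr1.
Qed.

Lemma value_nat n : value n%:R n%:R.
Proof. by have := value_tofrac n%:R; rewrite !rmorph_nat. Qed.

Lemma value0 : value 0 0. Proof. exact: (value_nat 0). Qed.
Lemma value1 : value 1 1. Proof. exact: (value_nat 1). Qed.

Lemma valueD f g a b : value f a -> value g b -> value (f + g) (a + b).
Proof.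
move=> [p [q [-> q0 ->]]] [p' [q' [-> q'0 ->]]].
exists (p * q' + p' * q), (q * q'); split.
- by rewrite addf_div ?tofrac_eq0 ?ev_neq0 // -!rmorphM -rmorphD.
- by rewrite rmorphM mulf_neq0.
- by rewrite addf_div // -!rmorphM -rmorphD.
Qed.

Lemma valueM f g a b : value f a -> value g b -> value (f * g) (a * b).
Proof.
move=> [p [q [-> q0 ->]]] [p' [q' [-> q'0 ->]]].
exists (p * p'), (q * q'); split.
- by rewrite mulf_div -!rmorphM.
- by rewrite rmorphM mulf_neq0.
- by rewrite mulf_div -!rmorphM.
Qed.

Lemma valueN f a : value f a -> value (- f) (- a).
Proof.
move=> [p [q [-> q0 ->]]]; exists (- p), q; split=> //.
  by rewrite rmorphN mulNr.
by rewrite rmorphN mulNr.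
Qed.

Lemma valueB f g a b : value f a -> value g b -> value (f - g) (a - b).
Proof. by move=> fa /valueN; apply: valueD. Qed.

Lemma valueV f a : value f a -> a != 0 -> value f^-1 a^-1.
Proof.
move=> [p [q [-> q0 ->]]]; rewrite mulf_eq0 negb_or => /andP[p0 _].
by exists q, p; rewrite !invf_div; split.
Qed.

Lemma value_div f g a b : value f a -> value g b -> b != 0 ->
  value (f / g) (a / b).
Proof. by move=> fa gb b0; apply: valueM fa _; apply: valueV. Qed.

Lemma valueXn f a n : value f a -> value (f ^+ n) (a ^+ n).
Proof.
move=> fa; elim: n => [|n IH]; first exact: value1.
by rewrite !exprS; apply: valueM.
Qed.

Lemma value_neq0 f c : value f c -> c != 0 -> f != 0.
Proof.
by move=> fc; apply: contra_neq => f0; apply: value_uniq fc _; rewrite f0; apply: value0.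
Qed.

(** Under an injective evaluation no denominator vanishes, so the arbitrary representative used by
    [frac_eval] does give the value. *)
Lemma value_total (evI : forall p, ev p = 0 -> p = 0) f :
  value f (ev \n_(repr f) / ev \d_(repr f)).
Proof.
exists \n_(repr f), \d_(repr f); split=> //; first exact: num_den_repr.
by apply: contraNneq (denom_ratioP (repr f)) => /evI ->.
Qed.

End PartialEvaluation.

Lemma value_poly_eval (P : idomainType) (A : fieldType) (ev : {rmorphism P -> A})
    (R : idomainType) (I : choiceType) (iota : {rmorphism R -> {fraction P}})
    (iota' : {rmorphism R -> A}) (v : I -> {fraction P}) (v' : I -> A)
    (p : ipoly R I) :
  (forall c, value ev (iota c) (iota' c)) -> (forall i, value ev (v i) (v' i)) ->
  value ev (poly_eval iota v p) (poly_eval iota' v' p).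
Proof.
move=> vc vv; elim/ipoly_ind: p => [c|i|p q IHp IHq|p q IHp IHq].
- by rewrite !poly_evalC.
- by rewrite !poly_evalX.
- by rewrite !rmorphD; apply: valueD.
- by rewrite !rmorphM; apply: valueM.
Qed.

Fact value_quotient_rule (P : idomainType) (A : fieldType)
    (ev : {rmorphism P -> A}) (D : {fraction P} -> {fraction P}) (d : P -> P)
    (d' : A -> A) f c :
  derivation d' -> (forall p, ev (d p) = d' (ev p)) ->
  (forall p q, q != 0 ->
     D (p%:F / q%:F) = (d p * q - p * d q)%:F / (q ^+ 2)%:F) ->
  value ev f c -> value ev (D f) (d' c).
Proof.
move=> dP evd DE [p [q [-> q0 ->]]]; rewrite DE ?(ev_neq0 q0) //.
exists (d p * q - p * d q), (q ^+ 2); split=> //.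
  by rewrite rmorphXn expf_neq0.
rewrite rmorphB rmorphXn !rmorphM !evd (derM dP) (derV dP).
by move: (ev p) (ev q) q0 (d' _) (d' _) => a b b0 a' b'; field.
Qed.

Lemma value_frac_der (R : idomainType) (I : choiceType) (v : I -> ipoly R I)
    (A : fieldType) (ev : {rmorphism ipoly R I -> A}) (d : A -> A) f c :
  derivation d -> (forall p, ev (poly_der v p) = d (ev p)) ->
  value ev f c -> value ev (frac_der v f) (d c).
Proof.
by move=> dP evd; apply: value_quotient_rule dP evd _; apply: frac_derE.
Qed.

Section MorphismDerivation.
Variables (P A : pzRingType) (ev : {rmorphism P -> A}) (d : P -> P) (d' : A -> A).
Hypotheses (dP : derivation d) (d'P : derivation d').
Variables p q : P.
Hypotheses (evp : ev (d p) = d' (ev p)) (evq : ev (d q) = d' (ev q)).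

Fact morph_derD : ev (d (p + q)) = d' (ev (p + q)).
Proof. by rewrite (derD dP) !rmorphD (derD d'P) evp evq. Qed.

Fact morph_derM : ev (d (p * q)) = d' (ev (p * q)).
Proof. by rewrite (derM dP) rmorphD !rmorphM (derM d'P) evp evq. Qed.

End MorphismDerivation.

Lemma eval_poly_der (R : idomainType) (I : choiceType) (v : I -> ipoly R I)
    (A : fieldType) (iota : {rmorphism R -> A}) (w : I -> A) (d : A -> A) p :
  derivation d -> (forall c, d (iota c) = 0) ->
  (forall i, d (w i) = poly_eval iota w (v i)) ->
  poly_eval iota w (poly_der v p) = d (poly_eval iota w p).
Proof.
move=> dP dc dw; have pD := poly_derivation v.
elim/ipoly_ind: p => [c|i|p q IHp IHq|p q IHp IHq].
- by rewrite poly_derC rmorph0 poly_evalC dc.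
- by rewrite poly_derX poly_evalX dw.
- exact: morph_derD.
- exact: morph_derM.
Qed.

(* Given a frame [v, w] and an array [u] of derivatives, [op e u] is the array
   of derivatives along [e], and [framed v w u i j] is the derivative of order
   [(i, j)] along [(v, w)], the coefficients of the vectors being treated as
   constants. *)
Section Frames.
Variable A : comNzRingType.
Implicit Types (e v w : A * A) (u F : nat -> nat -> A).

Definition op e u : nat -> nat -> A :=
  fun a b => e.1 * u a.+1 b + e.2 * u a b.+1.

Definition framed v w u : nat -> nat -> A :=
  fun i j => iter i (op v) (iter j (op w) u) 0%N 0%N.

Definition lincomb v w e : A * A :=
  (e.1 * v.1 + e.2 * w.1, e.1 * v.2 + e.2 * w.2).

Lemma op_comm v w u : op v (op w u) = op w (op v u).
Proof. by apply: funext => a; apply: funext => b; rewrite /op; ring. Qed.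

Lemma iter_op_comm v w i u : iter i (op v) (op w u) = op w (iter i (op v) u).
Proof. by elim: i => //= i ->; rewrite op_comm. Qed.

Lemma op_lincomb v w s t u a b :
  op (lincomb v w (s, t)) u a b = s * op v u a b + t * op w u a b.
Proof. by rewrite /op /lincomb /=; ring. Qed.

Lemma iter_op_lin v i c c' (F F' : nat -> nat -> A) a b :
  iter i (op v) (fun a b => c * F a b + c' * F' a b) a b =
  c * iter i (op v) F a b + c' * iter i (op v) F' a b.
Proof. by elim: i a b => //= i IH a b; rewrite /op !IH; ring. Qed.

(** Constant-coefficient operators commute and are linear in the vector: differentiating along [e]
    in the new coordinates is differentiating along the vector whose components in the frame
    [(v, w)] are [e]. Through [framed_comp] this makes the prolongation compatible with products of
    matrices. *)
Lemma op_framed v w e u :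
  op e (framed v w u) = framed v w (op (lincomb v w e) u).
Proof.
case: e => s t; apply: funext => i; apply: funext => j.
rewrite {1}/op /framed /=.
have -> : iter j (op w) (op (lincomb v w (s, t)) u) =
    fun a b => s * iter j (op w) (op v u) a b + t * iter j (op w) (op w u) a b.
  apply: funext => a; apply: funext => b; rewrite -iter_op_lin.
  by congr (iter j _ _ a b); apply: funext => a'; apply: funext => b';
    rewrite op_lincomb.
by rewrite iter_op_lin !iter_op_comm.
Qed.

Lemma framed_comp v w v' w' u :
  framed v' w' (framed v w u) = framed (lincomb v w v') (lincomb v w w') u.
Proof.
have iterE e i F : iter i (op e) (framed v w F) =
    framed v w (iter i (op (lincomb v w e)) F).
  by elim: i => //= i ->; rewrite op_framed.
apply: funext => i; apply: funext => j.
by rewrite {1}/framed !iterE.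
Qed.

Lemma framed_id u : framed (1, 0) (0, 1) u = u.
Proof.
have E0 F j a b : iter j (op (0, 1)) F a b = F a (j + b)%N.
  by elim: j a b => //= j IH a b; rewrite /op !IH /= mul0r add0r mul1r addnS.
have E1 F i a b : iter i (op (1, 0)) F a b = F (i + a)%N b.
  by elim: i a b => //= i IH a b; rewrite /op !IH /= mul0r addr0 mul1r addnS.
by apply: funext => i; apply: funext => j; rewrite /framed E1 E0 !addn0.
Qed.

End Frames.

Section FramedDerivation.
Variables (A : comNzRingType) (d : A -> A) (dP : derivation d).
Variables (u : nat -> nat -> A) (v w : A * A).

Let J := framed v w u.

Lemma der_op e F a b : d (op e F a b) =
  op (d e.1, d e.2) F a b + op e (fun a b => d (F a b)) a b.
Proof. by rewrite /op (derD dP) !(derM dP) /=; ring. Qed.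

(* Here d differentiates u along p v + q w, and dv = a v + b w,
   dw = c v + e w. *)
Lemma der_framed (p q a b c e : A) :
  (forall k l, d (u k l) = op (lincomb v w (p, q)) u k l) ->
  (d v.1, d v.2) = lincomb v w (a, b) ->
  (d w.1, d w.2) = lincomb v w (c, e) ->
  forall i j, d (J i j) = p * J i.+1 j + q * J i j.+1
    + i%:R * (a * J i j + b * J i.-1 j.+1)
    + j%:R * (c * J i.+1 j.-1 + e * J i j).
Proof.
move=> du dv dw.
(* The identity for the corner entries alone is not inductive, since [op] reads neighbouring
   entries; it is proved for all entries [k l] of the intermediate arrays [T i j]. *)
have [T [T0 Tv Tw TJ]] : exists T : nat -> nat -> nat -> nat -> A,
    [/\ T 0%N 0%N = u, forall i j, op v (T i j) = T i.+1 j,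
        forall i j, op w (T i j) = T i j.+1 &
        forall i j, T i j 0%N 0%N = J i j].
  exists (fun i j => iter i (op v) (iter j (op w) u)); split=> // i j.
  by rewrite -iter_op_comm.
have opD z (F G : nat -> nat -> A) k l :
    op z (fun k l => F k l + G k l) k l = op z F k l + op z G k l.
  by rewrite /op; ring.
have opM z (s : A) (F : nat -> nat -> A) k l :
    op z (fun k l => s * F k l) k l = s * op z F k l.
  by rewrite /op; ring.
suff dT i j k l : d (T i j k l) = p * T i.+1 j k l + q * T i j.+1 k l
    + i%:R * (a * T i j k l + b * T i.-1 j.+1 k l)
    + j%:R * (c * T i.+1 j.-1 k l + e * T i j k l).
  by move=> i j; rewrite -!TJ.
elim: i k l => [|i IHi] k l.
  elim: j k l => [|j IHj] k l.
    by rewrite T0 du op_lincomb -T0 Tv Tw !mul0r !addr0.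
  rewrite -Tw der_op dw op_lincomb Tv Tw.
  under [X in op w X]eq_fun2 => k' l' do rewrite IHj.
  rewrite !(opD, opM) !(Tw, Tv) !mul0r !addr0 -natr1.
  (* The truncated predecessor of 0 occurs only with the factor [0%:R]. *)
  by case: j {IHj} => [|j]; rewrite !succnK ?mulr0n; ring.
rewrite -Tv der_op dv op_lincomb Tv Tw.
under [X in op v X]eq_fun2 => k' l' do rewrite IHi.
rewrite !(opD, opM) !Tv -natr1.
by case: i {IHi} => [|i]; rewrite !succnK ?mulr0n; ring.
Qed.

End FramedDerivation.

Section FramedValue.
Variables (P : idomainType) (A : fieldType) (ev : {rmorphism P -> A}).
Local Notation K := {fraction P}.

Definition value2 (e : K * K) (e' : A * A) : Prop :=
  value ev e.1 e'.1 /\ value ev e.2 e'.2.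

Lemma value_framed (v w : K * K) (v' w' : A * A) u u' :
  value2 v v' -> value2 w w' -> (forall a b, value ev (u a b) (u' a b)) ->
  forall i j, value ev (framed v w u i j) (framed v' w' u' i j).
Proof.
have V_op z z' F F' : value2 z z' -> (forall a b, value ev (F a b) (F' a b)) ->
    forall a b, value ev (op z F a b) (op z' F' a b).
  by move=> [z1 z2] FF a b; apply: valueD; apply: valueM.
have V_it z z' i F F' : value2 z z' -> (forall a b, value ev (F a b) (F' a b)) ->
    forall a b, value ev (iter i (op z) F a b) (iter i (op z') F' a b).
  by move=> zz FF; elim: i => //= i IH; apply: V_op.
by move=> vv ww uu i j; apply: (V_it) => //; apply: V_it.
Qed.

End FramedValue.

(** * The structure equations *)

Section FrameErrors.
Variables (F : fieldType) (d1 d2 : F -> F).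
Hypotheses (d1P : derivation d1) (d2P : derivation d2).
Variables (al be ga de : F) (J : nat -> nat -> F).

(* The coefficients of the curvature of the connection
   nabla_1 v = v, nabla_1 w = al v + be w, nabla_2 v = w,
   nabla_2 w = ga v + de w, where [nabla_1, nabla_2] = al nabla_1 +
   (be - 1) nabla_2. *)
Definition curv1 : F :=
  d1 ga + ga + de * al - d2 al - be * ga - al ^+ 2 - (be - 1) * ga.
Definition curv2 : F :=
  d1 de - al - d2 be - al * be - (be - 1) * de.

Definition comm_err (f : F) : F :=
  d1 (d2 f) - d2 (d1 f) - (al * d1 f + (be - 1) * d2 f).

Definition err1 i j : F := d1 (J i j)
  - (J i.+1 j + i%:R * J i j + j%:R * (al * J i.+1 j.-1 + be * J i j)).
Definition err2 i j : F := d2 (J i j)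
  - (J i j.+1 + i%:R * J i.-1 j.+1 + j%:R * (ga * J i.+1 j.-1 + de * J i j)).

(** Solve [err2 i j] for [J i j.+1], apply [d1], and exchange [d1] and [d2] at the cost of
    [comm_err]. The remaining [err1] terms lie in columns up to [j], or in column [j.+1] with a
    smaller first index. The curvature has the factor [j] because only the arguments [w] contribute:
    on [v] it vanishes by the form of the commutator. *)
Lemma err1_step i j : err1 i j.+1 =
  comm_err (J i j) + d2 (err1 i j) - d1 (err2 i j)
  + (al - j%:R * de) * err1 i j + (be - 1 + i%:R + j%:R * be) * err2 i j
  - i%:R * err1 i.-1 j.+1 + err2 i.+1 j
  + j%:R * (al * err2 i.+1 j.-1 - ga * err1 i.+1 j.-1)
  - j%:R * (J i.+1 j.-1 * curv1 + J i j * curv2).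
Proof.
rewrite /err1 /err2 /comm_err /curv1 /curv2.
rewrite !(derB d1P, derB d2P, derD d1P, derD d2P, derM d1P, derM d2P).
rewrite !(der_nat d1P, der_nat d2P).
case: i => [|i]; case: j => [|j]; rewrite ?succnK ?mulr0n -?natr1; ring.
Qed.

(** Here [v] and [w] stand for the same component of the two frame fields, and [comm_err w] is that
    component of the curvature applied to [w]. With both components, independence of the frame kills
    [curv1] and [curv2]. *)
Lemma curv_relation v w : d1 v = v -> d2 v = w ->
  d1 w = al * v + be * w -> d2 w = ga * v + de * w -> comm_err w = 0 ->
  curv1 * v + curv2 * w = 0.
Proof.
move=> d1v d2v d1w d2w; rewrite /comm_err d1w d2w.
rewrite (derD d1P) (derD d2P) !(derM d1P) !(derM d2P) d1v d2v d1w d2w => <-.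
by rewrite /curv1 /curv2; ring.
Qed.

End FrameErrors.

Section StructureEquations.
Variables (F : fieldType) (d1 d2 : F -> F).
Hypotheses (d1P : derivation d1) (d2P : derivation d2).
Variables y b : F.

Let r := d1 y.
Let s := d1 r - r.

(** [al] and [be] solve [err1 0 1 = 0] and [err1 1 1 = 0], [ga] and [de] solve [err2 0 1 = 0] and
    [err2 1 1 = 0], where [J 2 1] and [J 1 2] are first eliminated by [err2 2 0 = 0] and
    [err1 0 2 = 0]. *)
Definition coef_al : F := r^-1.
Definition coef_be : F := d2 s + 1 + s / r.
Definition coef_ga : F := - (b / r).
Definition coef_de : F := d1 b + 2 / r - 2 * coef_be * b + b - b * s / r.

Local Notation al := coef_al.
Local Notation be := coef_be.
Local Notation ga := coef_ga.
Local Notation de := coef_de.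

Lemma comm_errE f : comm_err d1 d2 al be f = rel3 d1 d2 y f.
Proof. by rewrite /comm_err /rel3 /al /be -/r -/s; ring. Qed.

Lemma curv1E : r != 0 ->
  curv1 d1 d2 al be ga de = rel2 d1 d2 y / r ^+ 2.
Proof.
move=> r0; rewrite /curv1 /de /ga /al /rel2 -/r.
rewrite !(derN d1P, derM d1P, derM d2P, derV d1P, derV d2P) /s.
by field.
Qed.

(** This is where R_4 comes from. The term [d1 de] contains [-2 * b * d1 (d2 s)] whereas [rel4]
    contains [d2 (d1 s)], hence the correction by [rel3] at [s]; the derivative [d2 r] coming from
    [d2 (s / r)] is replaced by -1 through [rel2]. *)
Lemma curv2E : r != 0 -> b != 0 -> 2 != 0 :> F ->
  curv2 d1 d2 al be de =
    - 2 * b * rel4 d1 d2 y b + s / r ^+ 2 * rel2 d1 d2 y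
    - 2 * b * rel3 d1 d2 y s.
Proof.
move=> r0 b0 t0; rewrite /curv2 /de /be /al /rel4 /rel3 /rel2 -/r -/s.
have ds : d1 r = s + r by rewrite /s subrK.
rewrite !(derB d1P, derD d1P, derD d2P, derM d1P, derM d2P, derV d1P, derV d2P).
rewrite !(der_nat d1P, der_nat d2P, der1 d1P, der1 d2P) ds.
by field; rewrite r0 b0 t0.
Qed.

(** The first column solves [err1 i 0 = 0] for the next entry; later columns solve [err2 i j = 0]
    for [J i j.+1]. [two_cols] carries columns [j] and [j.+1] because the coefficient [ga] brings in
    column [j.-1]. *)
Fixpoint first_col i : F :=
  if i is i'.+1 then d1 (first_col i') - i'%:R * first_col i' else y.

Fixpoint second_col i : F :=
  match i with
  | 0 => 0
  | 1 => -1
  | i'.+1 => d2 (first_col i) - i%:R * second_col i'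
  end.

Fixpoint next_col (prev cur : nat -> F) j i : F :=
  d2 (cur i) - (if i is i'.+1 then i%:R * next_col prev cur j i' else 0)
  - j%:R * (ga * prev i.+1 + de * cur i).

Fixpoint two_cols j : (nat -> F) * (nat -> F) :=
  if j is j'.+1 then
    ((two_cols j').2, next_col (two_cols j').1 (two_cols j').2 j)
  else (first_col, second_col).

(* The components J_ij = d^{i+j} u (v, .., v, w, .., w) of the normalized jet,
   as differential rational functions of y = J_00 and b = J_02. *)
Definition normal_jet i j : F := (two_cols j).1 i.
Local Notation J := normal_jet.

Lemma normal_jetS0 i : J i.+1 0 = d1 (J i 0) - i%:R * J i 0.
Proof. by []. Qed.

Lemma normal_jetSS1 i : J i.+2 1 = d2 (J i.+2 0) - i.+2%:R * J i.+1 1.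
Proof. by []. Qed.

Lemma normal_jetSS i j : J i j.+2 =
  d2 (J i j.+1) - i%:R * J i.-1 j.+2 - j.+1%:R * (ga * J i.+1 j + de * J i j.+1).
Proof. by case: i => [|i] //; rewrite /J /= mul0r. Qed.

Lemma normal_jet20 : J 2 0 = s.
Proof. by rewrite !normal_jetS0 mul0r subr0 mul1r. Qed.

Lemma normal_jet10 : J 1 0 = r.
Proof. by rewrite normal_jetS0 mul0r subr0. Qed.

Lemma normal_jet02 : r != 0 -> J 0 2 = b.
Proof.
move=> r0; rewrite normal_jetSS (der0 d2P) mulr0 addr0 normal_jet10 /ga.
by rewrite mul0r mul1r; field.
Qed.

Lemma normal_jet21 : J 2 1 = d2 s + 2.
Proof. by rewrite normal_jetSS1 normal_jet20 mulrN1 opprK. Qed.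

Lemma normal_jet12 : r != 0 -> J 1 2 = d1 b + 2 / r - 2 * be * b.
Proof.
move=> r0; rewrite normal_jetSS normal_jet02 // normal_jet20.
by rewrite (_ : J 1 1 = -1) // (derN d2P) (der1 d2P) /de /ga; field.
Qed.

(** With the two lemmas that follow, the connection coefficients become polynomials in the [J i j]
    and [al], so the right-hand sides of the structure equations are normal forms. *)
Lemma coef_beE : be = J 2 1 - 1 + J 2 0 * al.
Proof. by rewrite normal_jet21 normal_jet20 /be /al; ring. Qed.

Lemma coef_gaE : r != 0 -> ga = - (J 0 2 * al).
Proof. by move=> r0; rewrite normal_jet02. Qed.

Lemma coef_deE : r != 0 -> de = J 1 2 + J 0 2 - J 0 2 * J 2 0 * al.
Proof. by move=> r0; rewrite normal_jet12 // normal_jet02 // normal_jet20. Qed.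

Lemma d1_coef_al : d1 al = - ((J 2 0 + J 1 0) * (al * al)).
Proof.
rewrite normal_jet20 normal_jet10 /s subrK /al (derV d1P) -/r expr2 invfM.
by ring.
Qed.

Lemma d2_coef_al : d2 al - al * al = - (al * al) * rel2 d1 d2 y.
Proof.
by rewrite /al (derV d2P) -/r /rel2 -/r expr2 invfM; ring.
Qed.

(** The recursion solves these equations except for the two prescribed entries [J 0 1 = 0] and
    [J 1 1 = -1]; at these places the equations become R_1 and R_2. *)
Lemma err2_normal_jet i j : err2 d2 ga de J i j =
  if (i, j) == (0%N, 0%N) then rel1 d2 y
  else if (i, j) == (1%N, 0%N) then rel2 d1 d2 y else 0.
Proof.
rewrite /err2; case: j => [|j].
  case: i => [|[|i]] /=.
  - by rewrite !mul0r !addr0 subr0.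
  - rewrite normal_jet10 /rel2 -/r.
    by rewrite (_ : J 1 1 = -1) // (_ : J 0 1 = 0) // mulr0 mul0r !addr0.
  by rewrite normal_jetSS1 mul0r addr0; ring.
by rewrite !xpair_eqE !andbF /= normal_jetSS; ring.
Qed.

Lemma normal_jet_uniq (J' : nat -> nat -> F) :
  J' 0 0 = y -> J' 0 1 = 0 -> J' 1 1 = -1 ->
  (forall i, d1 (J' i 0) = J' i.+1 0 + i%:R * J' i 0) ->
  (forall i j, err2 d2 ga de J' i j = 0) -> forall i j, J' i j = J i j.
Proof.
move=> J00 J01 J11 J'1 J'2 i j; move: i.
suff: (forall i, J' i j = J i j) /\ (forall i, J' i j.+1 = J i j.+1) by case.
elim: j => [|j [IHj IHj1]].
  have c0 i : J' i 0 = J i 0.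
    by elim: i => // i IHi; rewrite normal_jetS0 -IHi J'1 addrK.
  split=> //; elim=> [|[|i] IHi] //; rewrite normal_jetSS1 -IHi -c0.
  by have := J'2 i.+2 0; rewrite /err2 /= => /eqP; rewrite subr_eq0 => /eqP->; ring.
split=> //; elim=> [|i IHi]; rewrite normal_jetSS -IHj -!IHj1.
  by have := J'2 0 j.+1; rewrite /err2 /= !mul0r addr0 subr0 => /eqP;
    rewrite subr_eq0 => /eqP->; ring.
by have := J'2 i.+1 j.+1; rewrite /err2 /= -IHi => /eqP;
  rewrite subr_eq0 => /eqP->; ring.
Qed.

Lemma err1_normal_jet0 i : err1 d1 al be J i 0 = 0.
Proof. by rewrite /err1 normal_jetS0; ring. Qed.

End StructureEquations.

(** * Structure equations modulo a differential ideal *)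

Section ErrorIdeal.
Variables (F : fieldType) (d1 d2 : F -> F).
Hypotheses (d1P : derivation d1) (d2P : derivation d2).
Variables loc C : F -> Prop.

(** Multipliers are restricted to the subring [loc], since an ideal of the field [F] itself would be
    trivial. *)
Record differential_ideal : Prop := DifferentialIdeal {
  locD : forall a c, loc a -> loc c -> loc (a + c);
  locM : forall a c, loc a -> loc c -> loc (a * c);
  locN : forall a, loc a -> loc (- a);
  loc_nat : forall n, loc n%:R;
  loc_d1 : forall a, loc a -> loc (d1 a);
  loc_d2 : forall a, loc a -> loc (d2 a);
  idealD : forall f g, C f -> C g -> C (f + g);
  idealM : forall a f, loc a -> C f -> C (a * f);
  ideal0 : C 0;
  ideal_d1 : forall f, C f -> C (d1 f);
  ideal_d2 : forall f, C f -> C (d2 f)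
}.

Hypothesis cP : differential_ideal.

Lemma idealN f : C f -> C (- f).
Proof.
by move=> Cf; rewrite -mulN1r; apply: (idealM cP) => //; apply/(locN cP)/(loc_nat cP 1).
Qed.

Lemma idealB f g : C f -> C g -> C (f - g).
Proof. by move=> Cf /idealN; apply: idealD. Qed.

Lemma locB a c : loc a -> loc c -> loc (a - c).
Proof. by move=> la /(locN cP); apply: locD. Qed.

Variables (al be ga de : F) (J : nat -> nat -> F).
Hypotheses (lal : loc al) (lbe : loc be) (lga : loc ga) (lde : loc de).
Hypothesis lJ : forall i j, loc (J i j).
Hypothesis C_comm : forall f, loc f -> C (comm_err d1 d2 al be f).
Hypothesis C_curv1 : C (curv1 d1 d2 al be ga de).
Hypothesis C_curv2 : C (curv2 d1 d2 al be de).
Hypothesis C_err2 : forall i j, C (err2 d2 ga de J i j).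
Hypothesis C_err10 : forall i, C (err1 d1 al be J i 0).

Ltac in_ideal := repeat first [ done | exact: (ideal0 cP)
  | exact: (loc_nat cP 1) | exact: (loc_nat cP) | exact: C_comm
  | apply: (ideal_d1 cP) | apply: (ideal_d2 cP)
  | apply: idealB | apply: (idealD cP) | apply: (idealM cP)
  | apply: locB | apply: (locD cP) | apply: (locM cP) ].

(** Induction on the column, with the previous column kept for [err1 i.+1 j.-1], and inside a column
    on [i], for [err1 i.-1 j.+1]. For [i = 0] the latter has the coefficient 0. *)
Lemma err1_in_ideal i j : C (err1 d1 al be J i j).
Proof.
suff: (forall i, C (err1 d1 al be J i j)) /\
      (forall i, C (err1 d1 al be J i j.-1)) by case=> + _; apply.
elim: j => {i} [|j [IHj IHj1]]; split=> //.
by elim=> [|i IHi]; rewrite (err1_step d1P d2P al be ga de) ?mul0r; in_ideal.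
Qed.

End ErrorIdeal.

Definition section_jet (A : pzRingType) (J : nat -> nat -> A) (v : jetvar) : A :=
  match v with Jx => 1 | Jy => 0 | Ju i j => J i j end.

Fact morph_common_denom (P A : comPzRingType) (h : {rmorphism P -> A}) p q x al n m :
  al * h x = 1 ->
  h p * al ^+ n + h q * al ^+ m = h (p * x ^+ m + q * x ^+ n) * al ^+ (n + m).
Proof.
move=> e; have en k : al ^+ k * h x ^+ k = 1 by rewrite -exprMn e expr1n.
rewrite rmorphD !rmorphM !rmorphXn /= exprD; move: (en n) (en m).
move: (h p) (h q) (al ^+ n) (al ^+ m) (h x ^+ n) (h x ^+ m).
move=> a c i j i' j' e1 e2.
transitivity (a * i * (j * j') + c * j * (i * i')); first by rewrite e1 e2 !mulr1.
by ring.
Qed.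

Fact morph_mul_denom (P A : comPzRingType) (h : {rmorphism P -> A}) p q al n m :
  h p * al ^+ n * (h q * al ^+ m) = h (p * q) * al ^+ (n + m).
Proof. by rewrite rmorphM exprD mulrACA. Qed.

(** * Normal forms modulo a differential ideal *)

Section NormalForms.
Variables (F : fieldType) (d1 d2 : F -> F).
Hypotheses (d1P : derivation d1) (d2P : derivation d2).
Variables loc C : F -> Prop.
Hypothesis cP : differential_ideal d1 d2 loc C.
Variables (R : idomainType) (iota : {rmorphism R -> F}).
Variables (al : F) (J : nat -> nat -> F).
Hypothesis loc_iota : forall c, loc (iota c).
Hypothesis loc_al : loc al.
Hypothesis loc_J : forall i j, loc (J i j).

Inductive normal_form : F -> Prop :=
| nf_const c : normal_form (iota c)
| nf_al : normal_form al
| nf_J i j : normal_form (J i j)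
| nfD f g : normal_form f -> normal_form g -> normal_form (f + g)
| nfM f g : normal_form f -> normal_form g -> normal_form (f * g).

(** [loc f] is carried along for the sake of products: in [g * (f - f') + f' * (g - g')] the
    multipliers must lie in [loc]. *)
Definition reducible f : Prop :=
  loc f /\ exists2 g, normal_form g & C (f - g).

Lemma nf_nat n : normal_form n%:R.
Proof. by rewrite -(rmorph_nat iota); apply: nf_const. Qed.

Lemma nfN f : normal_form f -> normal_form (- f).
Proof.
move=> nf; rewrite -mulN1r; apply: nfM => //.
by rewrite -(rmorph1 iota) -rmorphN; apply: nf_const.
Qed.

Lemma nfB f g : normal_form f -> normal_form g -> normal_form (f - g).
Proof. by move=> nf /nfN; apply: nfD. Qed.

Lemma loc_nf f : normal_form f -> loc f.
Proof. by elim=> // *; [apply: (locD cP) | apply: (locM cP)]. Qed.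

Lemma nf_reducible f : normal_form f -> reducible f.
Proof.
by move=> nf; split; [exact: loc_nf | exists f; rewrite ?subrr //; exact: (ideal0 cP)].
Qed.

Lemma reducibleD f g : reducible f -> reducible g -> reducible (f + g).
Proof.
move=> [lf [f' nf cf]] [lg [g' ng cg]]; split; first exact: (locD cP).
exists (f' + g'); first exact: nfD.
by rewrite opprD addrACA; apply: (idealD cP).
Qed.

Lemma reducibleM f g : reducible f -> reducible g -> reducible (f * g).
Proof.
move=> [lf [f' nf cf]] [lg [g' ng cg]]; split; first exact: (locM cP).
exists (f' * g'); first exact: nfM.
have -> : f * g - f' * g' = g * (f - f') + f' * (g - g') by ring.
by apply: (idealD cP); apply: (idealM cP) => //; apply: loc_nf.
Qed.

Lemma reducible_der (d : F -> F) : derivation d ->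
  (forall f, loc f -> loc (d f)) -> (forall f, C f -> C (d f)) ->
  (forall c, d (iota c) = 0) -> reducible (d al) ->
  (forall i j, reducible (d (J i j))) -> forall f, reducible f -> reducible (d f).
Proof.
move=> dP ld Cd dc dal dJ f [lf [g nf cfg]].
suff [_ [g' ng' cg']] : reducible (d g).
  split; first exact: ld.
  exists g' => //; have -> : d f - g' = d (f - g) + (d g - g').
    by rewrite (derB dP); ring.
  by apply: (idealD cP) => //; apply: Cd.
elim: {f lf cfg} nf => [c|||f1 f2 n1 IH1 n2 IH2|f1 f2 n1 IH1 n2 IH2] //.
- by rewrite dc; apply/nf_reducible/(nf_nat 0).
- by rewrite (derD dP); apply: reducibleD.
- by rewrite (derM dP); apply: reducibleD; apply: reducibleM => //;
    apply: nf_reducible.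
Qed.

Lemma nf_poly_eval f : al * J 1 0 = 1 -> normal_form f ->
  exists (p : ipoly R jetvar) n, f = poly_eval iota (section_jet J) p * al ^+ n.
Proof.
move=> e; have eX : al * poly_eval iota (section_jet J) (var R (Ju 1 0)) = 1.
  by rewrite poly_evalX.
elim=> {f} [c||i j|f g _ [p [n ->]] _ [q [m ->]]|f g _ [p [n ->]] _ [q [m ->]]].
- by exists c%:MP, 0%N; rewrite poly_evalC mulr1.
- by exists 1, 1%N; rewrite rmorph1 mul1r.
- by exists (var R (Ju i j)), 0%N; rewrite poly_evalX mulr1.
- exists (p * var R (Ju 1 0) ^+ m + q * var R (Ju 1 0) ^+ n), (n + m)%N.
  exact: morph_common_denom _ _ _ _ eX.
- by exists (p * q), (n + m)%N; apply: morph_mul_denom.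
Qed.

End NormalForms.

(** * The invariant frame *)

Section JetFrame.
Variables (A : fieldType) (th : jetvar -> A).

Definition jet_array i j : A := th (Ju i j).

Local Notation x := (th Jx).
Local Notation y := (th Jy).
Local Notation u := jet_array.

(** I_1 and, below, I_2b at a jet with coordinates in any field: real jets, the generic jet and its
    transforms are treated alike. *)
Definition euler_det : A := x * u 1 0 + y * u 0 1.
Definition hess_det : A :=
  x * u 0 1 * u 2 0 - y * u 1 0 * u 0 2 + (y * u 0 1 - x * u 1 0) * u 1 1.

Definition frame1 : A * A := (x, y).
Definition frame2 : A * A := (- (u 0 1 / hess_det), u 1 0 / hess_det).

Definition frame_jet : nat -> nat -> A := framed frame1 frame2 u.

Lemma frame_jet10 : frame_jet 1 0 = euler_det.
Proof. by []. Qed.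

Lemma frame_jet20 : frame_jet 2 0 =
  x ^+ 2 * u 2 0 + 2 * x * y * u 1 1 + y ^+ 2 * u 0 2.
Proof. by rewrite /frame_jet /framed /op /=; ring. Qed.

Hypothesis hess0 : hess_det != 0.

Lemma frame_jet01 : frame_jet 0 1 = 0.
Proof. by rewrite /frame_jet /framed /op /=; field. Qed.

Lemma frame_jet02 : frame_jet 0 2 = hess_det ^- 2 *
  (u 1 0 ^+ 2 * u 0 2 - 2 * u 1 0 * u 0 1 * u 1 1 + u 0 1 ^+ 2 * u 2 0).
Proof. by rewrite /frame_jet /framed /op /=; field. Qed.

(** The Hessian of u on v and the Hamiltonian vector is -I_2b; this dictates the factor I_2b^-1 in
    w. *)
Lemma frame_jet11 : frame_jet 1 1 = -1.
Proof.
apply: (mulIf hess0); rewrite mulN1r [X in - X]/hess_det.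
by rewrite /frame_jet /framed /op /=; field.
Qed.

Hypothesis euler0 : euler_det != 0.

Lemma frame_det : frame1.1 * frame2.2 - frame1.2 * frame2.1 = euler_det / hess_det.
Proof. by rewrite /euler_det /=; field. Qed.

Lemma frame_indep s t : lincomb frame1 frame2 (s, t) = (0, 0) -> s = 0 /\ t = 0.
Proof.
move=> e; have dn0 : euler_det / hess_det != 0.
  by rewrite mulf_neq0 ?invr_eq0.
rewrite -frame_det in dn0; move: e dn0.
move: frame1 frame2 => [a b] [c d] /= [e1 e2] dn0.
split; apply: (mulIf dn0); rewrite mul0r.
  transitivity ((s * a + t * c) * d - (s * b + t * d) * c); first by ring.
  by rewrite e1 e2; ring.
transitivity ((s * b + t * d) * a - (s * a + t * c) * b); first by ring.
by rewrite e1 e2; ring.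
Qed.

Lemma frame_span e : exists s t, e = lincomb frame1 frame2 (s, t).
Proof.
have dn0 : euler_det / hess_det != 0 by rewrite mulf_neq0 ?invr_eq0.
rewrite -frame_det in dn0.
exists ((e.1 * frame2.2 - e.2 * frame2.1) /
  (frame1.1 * frame2.2 - frame1.2 * frame2.1)).
exists ((e.2 * frame1.1 - e.1 * frame1.2) /
  (frame1.1 * frame2.2 - frame1.2 * frame2.1)).
case: e => e1 e2; rewrite /lincomb.
move: dn0; move: (frame1) (frame2) => [a b] [c d] /= dn0.
by congr (_, _); field.
Qed.

End JetFrame.

Lemma frame_jet_section (A : fieldType) (J : nat -> nat -> A) :
  J 0 1 = 0 -> J 1 1 = -1 -> J 1 0 != 0 ->
  [/\ hess_det (section_jet J) = J 1 0, euler_det (section_jet J) = J 1 0 &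
      forall i j, frame_jet (section_jet J) i j = J i j].
Proof.
move=> J01 J11 J10.
have h : hess_det (section_jet J) = J 1 0.
  by rewrite /hess_det /jet_array /= J01 J11; ring.
split=> // [|i j]; first by rewrite /euler_det /jet_array /=; ring.
rewrite /frame_jet /frame1 /frame2 h /jet_array /= J01 mul0r oppr0 mulfV //.
by rewrite framed_id.
Qed.

Section DifferentialField.
Variables (F : fieldType) (Dx Dy : F -> F) (th : jetvar -> F).
Hypotheses (DxP : derivation Dx) (DyP : derivation Dy).
Hypothesis Dxy : forall f, Dx (Dy f) = Dy (Dx f).
Hypotheses (Dxx : Dx (th Jx) = 1) (Dxy0 : Dx (th Jy) = 0).
Hypotheses (Dyx0 : Dy (th Jx) = 0) (Dyy : Dy (th Jy) = 1).
Hypothesis Dxu : forall i j, Dx (th (Ju i j)) = th (Ju i.+1 j).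
Hypothesis Dyu : forall i j, Dy (th (Ju i j)) = th (Ju i j.+1).

Definition along (e : F * F) (f : F) : F := e.1 * Dx f + e.2 * Dy f.

Lemma along_derivation e : derivation (along e).
Proof.
split=> f g; rewrite /along ?(derD DxP) ?(derD DyP) ?(derM DxP) ?(derM DyP); ring.
Qed.

Lemma along_const e c : Dx c = 0 -> Dy c = 0 -> along e c = 0.
Proof. by move=> cx cy; rewrite /along cx cy !mulr0 addr0. Qed.

Local Notation v := (frame1 th).
Local Notation w := (frame2 th).
Local Notation d1 := (along v).
Local Notation d2 := (along w).
Local Notation J := (frame_jet th).
Let d1P := along_derivation v.
Let d2P := along_derivation w.

Hypotheses (hess0 : hess_det th != 0) (euler0 : euler_det th != 0).

Lemma along_array e k l : along e (jet_array th k l) = op e (jet_array th) k l.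
Proof. by rewrite /along /op /jet_array Dxu Dyu. Qed.

Lemma along_frame1 e : (along e v.1, along e v.2) = e.
Proof. by case: e => a b; rewrite /along Dxx Dxy0 Dyx0 Dyy /=; congr (_, _); ring. Qed.

Lemma along_comm e e' f : along e (along e' f) - along e' (along e f) =
  along (along e e'.1 - along e' e.1, along e e'.2 - along e' e.2) f.
Proof.
rewrite [along e' f]/along [along e f]/along.
have E a b c : along c (a * Dx f + b * Dy f) =
    along c a * Dx f + along c b * Dy f
    + (c.1 * a * Dx (Dx f) + (c.1 * b + c.2 * a) * Dy (Dx f) + c.2 * b * Dy (Dy f)).
  rewrite /along (derD DxP) (derD DyP) !(derM DxP) !(derM DyP) Dxy; ring.
by rewrite !E [RHS]/along /=; ring.
Qed.

Let y0 := J 0 0.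
Let b0 := J 0 2.
Local Notation al := (coef_al d1 y0).
Local Notation be := (coef_be d1 d2 y0).
Local Notation ga := (coef_ga d1 y0 b0).
Local Notation de := (coef_de d1 d2 y0 b0).

Lemma along_frame1_jet00 : d1 y0 = J 1 0.
Proof. by rewrite /y0 along_array. Qed.

Lemma structure_equations :
  [/\ (d1 w.1, d1 w.2) = lincomb v w (al, be),
      (d2 w.1, d2 w.2) = lincomb v w (ga, de),
      forall i j, err1 d1 al be J i j = 0 &
      forall i j, err2 d2 ga de J i j = 0].
Proof.
(* Coefficients exist because the frame is a basis. [der_framed] then yields the structure equations
   with these unknowns, and the constancy of [J 0 1] and [J 1 1] forces the closed formulas. *)
have [a [b eab]] := frame_span hess0 euler0 (d1 w.1, d1 w.2).
have [c [e ece]] := frame_span hess0 euler0 (d2 w.1, d2 w.2).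
have id1 : lincomb v w (1, 0) = v.
  by rewrite /lincomb /= !mul1r !mul0r !addr0.
have id2 : lincomb v w (0, 1) = w.
  by rewrite /lincomb /= !mul0r !mul1r !add0r.
have E1 i j : err1 d1 a b J i j = 0.
  rewrite /err1 /frame_jet (@der_framed _ _ d1P _ _ _ 1 0 1 0 a b) ?id1 //.
  - by ring.
  - by move=> k l; exact: along_array.
  - exact: along_frame1.
have E2 i j : err2 d2 c e J i j = 0.
  rewrite /err2 /frame_jet (@der_framed _ _ d2P _ _ _ 0 1 0 1 c e) ?id2 //.
  - by ring.
  - by move=> k l; exact: along_array.
  - exact: along_frame1.
have r0 : J 1 0 != 0 by rewrite frame_jet10.
have [J01 J11] := (frame_jet01 hess0, frame_jet11 hess0).
have er : d1 y0 = J 1 0 := along_frame1_jet00.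
have es : d1 (J 1 0) - J 1 0 = J 2 0.
  by have := E1 1%N 0%N; rewrite /err1 /= => /eqP; rewrite subr_eq0 => /eqP->; ring.
have ea : a = (J 1 0)^-1.
  have := E1 0%N 1%N; rewrite /err1 /= J01 J11 (der0 d1P) => e1.
  apply: (mulIf r0); rewrite mulVf //; apply/eqP; rewrite -subr_eq0.
  by apply/eqP; rewrite -oppr0 -e1; ring.
have e21 : J 2 1 = d2 (J 2 0) + 2.
  have := E2 2%N 0%N; rewrite /err2 /= J11 => /eqP; rewrite subr_eq0 => /eqP->.
  by ring.
have eb : b = d2 (J 2 0) + 1 + J 2 0 / J 1 0.
  have := E1 1%N 1%N; rewrite /err1 /= J11 (derN d1P) (der1 d1P) e21 ea => e1.
  by apply/eqP; rewrite -subr_eq0; apply/eqP; rewrite -e1; ring.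
have ec : c = - (b0 / J 1 0).
  have := E2 0%N 1%N; rewrite /err2 /= J01 (der0 d2P) -/b0 => e1.
  apply: (mulIf r0); rewrite mulNr divfK //; apply/eqP; rewrite -subr_eq0.
  by apply/eqP; rewrite -oppr0 -e1; ring.
have e12 : J 1 2 = d1 b0 + 2 / J 1 0 - 2 * b * b0.
  have := E1 0%N 2%N; rewrite /err1 /= J11 ea -/b0 => /eqP.
  by rewrite subr_eq0 => /eqP->; ring.
have ee : e = d1 b0 + 2 / J 1 0 - 2 * b * b0 + b0 - b0 * J 2 0 / J 1 0.
  have := E2 1%N 1%N; rewrite /err2 /= J11 (derN d2P) (der1 d2P) e12 ec -/b0 => e1.
  by apply/eqP; rewrite -subr_eq0; apply/eqP; rewrite -e1; ring.
have -> : al = a by rewrite /coef_al er ea.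
have -> : ga = c by rewrite /coef_ga er ec.
have ebe : be = b by rewrite /coef_be er es eb.
have -> : de = e by rewrite /coef_de ebe er es ee.
by rewrite ebe.
Qed.

(** The bracket of the two fields is nabla_1 w - nabla_2 v = al v + be w - w, hence the coefficient
    [be - 1]. *)
Lemma frame_comm f : comm_err d1 d2 al be f = 0.
Proof.
have [e1 e2 _ _] := structure_equations.
rewrite /comm_err along_comm.
have [-> ->] : d1 w.1 = (lincomb v w (al, be)).1 /\ d1 w.2 = (lincomb v w (al, be)).2.
  by rewrite -e1.
have [-> ->] : d2 v.1 = w.1 /\ d2 v.2 = w.2.
  by have := along_frame1 w; case: (w) => a b [-> ->].
by rewrite /along /lincomb /=; ring.
Qed.

Lemma frame_curv : curv1 d1 d2 al be ga de = 0 /\ curv2 d1 d2 al be de = 0.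
Proof.
have [e1 e2 _ _] := structure_equations.
apply: (frame_indep hess0 euler0); congr (_, _).
  apply: (curv_relation d1P d2P) (frame_comm _).
  - exact: (congr1 (@fst F F) (along_frame1 v)).
  - exact: (congr1 (@fst F F) (along_frame1 w)).
  - exact: (congr1 (@fst F F) e1).
  - exact: (congr1 (@fst F F) e2).
apply: (curv_relation d1P d2P) (frame_comm _).
- exact: (congr1 (@snd F F) (along_frame1 v)).
- exact: (congr1 (@snd F F) (along_frame1 w)).
- exact: (congr1 (@snd F F) e1).
- exact: (congr1 (@snd F F) e2).
Qed.

(** [rel4] is recovered from the vanishing of [curv2], where it occurs with the factor [-2 * b0];
    the last clause assumes that this factor is nonzero. *)
Theorem frame_relations :
  [/\ rel1 d2 y0 = 0, rel2 d1 d2 y0 = 0,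
      forall f, rel3 d1 d2 y0 f = 0 &
      b0 != 0 -> 2 != 0 :> F -> rel4 d1 d2 y0 b0 = 0].
Proof.
have [_ _ E1 E2] := structure_equations.
have [c1 c2] := frame_curv.
have R3 f : rel3 d1 d2 y0 f = 0 by rewrite -comm_errE // frame_comm.
have R2 : rel2 d1 d2 y0 = 0.
  rewrite /rel2 along_frame1_jet00; have := E2 1%N 0%N; rewrite /err2 /=.
  by rewrite frame_jet11 // frame_jet01 // => <-; ring.
split=> // [|bn0 tn0].
  rewrite /rel1; have := E2 0%N 0%N; rewrite /err2 /=.
  by rewrite frame_jet01 // => <-; ring.
have r0 : d1 y0 != 0 by rewrite along_frame1_jet00 frame_jet10.
move: c2; rewrite (curv2E d1P d2P r0 bn0 tn0) R2 R3 !mulr0 addr0 subr0.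
by move/eqP; rewrite !mulf_eq0 oppr_eq0 (negPf tn0) (negPf bn0) => /eqP.
Qed.

Lemma frame_jet_normal i j : J i j = normal_jet d1 d2 y0 b0 i j.
Proof.
have [_ _ E1 E2] := structure_equations.
apply: normal_jet_uniq => //; rewrite ?frame_jet01 ?frame_jet11 //.
move=> k; have := E1 k 0%N; rewrite /err1 /= => /eqP; rewrite subr_eq0 => /eqP->.
by ring.
Qed.

End DifferentialField.

(** * The field of rational functions on the jet space *)

Lemma frac_der_const (R : idomainType) (I : choiceType) (v : I -> ipoly R I) c :
  frac_der v (c%:MP : ipoly R I)%:F = 0.
Proof. by rewrite frac_der_tofrac poly_derC rmorph0. Qed.

Lemma frac_der_var (R : idomainType) (I : choiceType) (v : I -> ipoly R I) i :
  frac_der v (var R i)%:F = (v i)%:F.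
Proof. by rewrite frac_der_tofrac poly_derX. Qed.

Lemma derivation_ext (R : idomainType) (I : choiceType)
    (d d' : {fraction ipoly R I} -> {fraction ipoly R I}) :
  derivation d -> derivation d' ->
  (forall c, d (c%:MP : ipoly R I)%:F = d' (c%:MP : ipoly R I)%:F) ->
  (forall i, d (var R i)%:F = d' (var R i)%:F) -> d =1 d'.
Proof.
move=> dP d'P dc dX.
have dpoly (p : ipoly R I) : d p%:F = d' p%:F.
  elim/ipoly_ind: p => [//|//|p q IHp IHq|p q IHp IHq].
    by rewrite tofracD (derD dP) (derD d'P) IHp IHq.
  by rewrite tofracM (derM dP) (derM d'P) IHp IHq.
elim/frac_ind => p q _.
by rewrite (derM dP) (derM d'P) (derV dP) (derV d'P) !dpoly.
Qed.

Lemma commutator_derivation (F : fieldType) (d d' : F -> F) :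
  derivation d -> derivation d' -> derivation (fun f => d (d' f) - d' (d f)).
Proof.
move=> dP d'P; split=> f g.
  by rewrite (derD d'P) (derD dP) (derD dP) (derD d'P); ring.
by rewrite (derM d'P) (derM dP f) (derD dP) (derD d'P) !(derM dP) !(derM d'P); ring.
Qed.

Lemma derivation0 (F : pzRingType) : derivation (fun _ : F => 0).
Proof. by split=> f g; rewrite ?mul0r ?mulr0 addr0. Qed.

Lemma value_section_jet (P : idomainType) (A : fieldType) (ev : {rmorphism P -> A})
    (J : nat -> nat -> {fraction P}) (J' : nat -> nat -> A) :
  (forall i j, value ev (J i j) (J' i j)) ->
  forall z, value ev (section_jet J z) (section_jet J' z).
Proof. by move=> JJ [||i j]; [exact: value1 | exact: value0 | exact: JJ]. Qed.

Section JetField.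
Variable R : realType.
Local Notation K := (jetfield R).

HB.instance Definition _ := GRing.RMorphism.copy (@jet_const R)
  (@FracField.tofrac (jetpoly R) \o @mkmalgU {cmonom jetvar} R mone).

Lemma Dx_derivation : derivation (@Dx R). Proof. exact: frac_derivation. Qed.
Lemma Dy_derivation : derivation (@Dy R). Proof. exact: frac_derivation. Qed.

Lemma Dx_const c : Dx (jet_const c) = 0 :> K. Proof. exact: frac_der_const. Qed.
Lemma Dy_const c : Dy (jet_const c) = 0 :> K. Proof. exact: frac_der_const. Qed.

Lemma Dx_jvar v : Dx (jvar R v) = (total_x R v)%:F.
Proof. exact: frac_der_var. Qed.

Lemma Dy_jvar v : Dy (jvar R v) = (total_y R v)%:F.
Proof. exact: frac_der_var. Qed.

Lemma DxDy (f : K) : Dx (Dy f) = Dy (Dx f).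
Proof.
apply/eqP; rewrite -subr_eq0; apply/eqP; move: f.
apply: derivation_ext (commutator_derivation Dx_derivation Dy_derivation)
  (@derivation0 K) _ _ => [c|v].
  rewrite -/(jet_const c) Dx_const Dy_const.
  by rewrite (der0 Dx_derivation) (der0 Dy_derivation) subrr.
rewrite -/(jvar R v) Dx_jvar Dy_jvar; case: v => [||i j] /=.
- by rewrite rmorph0 rmorph1 (der0 Dx_derivation) (der1 Dy_derivation) subrr.
- by rewrite rmorph0 rmorph1 (der1 Dx_derivation) (der0 Dy_derivation) subrr.
- have e : Dx (jvar R (Ju i j.+1)) - Dy (jvar R (Ju i.+1 j)) = 0.
    by rewrite Dx_jvar Dy_jvar subrr.
  exact: e.
Qed.

Local Notation th := (jvar R).
Local Notation v := (frame1 th).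
Local Notation w := (frame2 th).

Lemma nabla1_along : @nabla1 R = along (@Dx R) (@Dy R) v.
Proof. by []. Qed.

Lemma nabla2_along : @nabla2' R = along (@Dx R) (@Dy R) w.
Proof.
apply: funext => f; rewrite /nabla2' /along /frame2 /jet_array -/(I2b R) /=.
rewrite -/(hess_det th); move: (hess_det th)^-1 (Dx f) (Dy f) => h a b.
by move: (jvar R (Ju 1 0)) (jvar R (Ju 0 1)) => c d; ring.
Qed.

(* The section of the action where the invariant frame is the standard one. *)
Definition section_eval (A : pzRingType) (th : jetvar -> A) : jetvar -> A :=
  section_jet (fun i j => match i, j with
    | 0, 1 => 0 | 1, 1 => -1 | _, _ => th (Ju i j) end).

Section Values.
Variables (A : fieldType) (iota : {rmorphism R -> A}) (t : jetvar -> A).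
Local Notation val := (value (poly_eval iota t)).

Lemma value_jvar z : val (jvar R z) (t z).
Proof. by rewrite -(poly_evalX iota t z); apply: value_tofrac. Qed.

Lemma value_const c : val (jet_const c) (iota c).
Proof. by rewrite -(poly_evalC iota t c); apply: value_tofrac. Qed.

Lemma value_euler_det : val (euler_det th) (euler_det t).
Proof. by apply: valueD; apply: valueM; apply: value_jvar. Qed.

Lemma value_hess_det : val (hess_det th) (hess_det t).
Proof.
rewrite /hess_det /jet_array; have V := value_jvar.
by apply: valueD; [apply: valueB | apply: valueM; first apply: valueB];
  rewrite -?mulrA; do ?apply: valueM; apply: V.
Qed.

Lemma value_frame1 : value2 (poly_eval iota t) v (frame1 t).
Proof. by split; apply: value_jvar. Qed.

Lemma value_frame2 : hess_det t != 0 -> value2 (poly_eval iota t) w (frame2 t).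
Proof.
move=> h; split; [apply: valueN|]; apply: value_div value_hess_det h;
  exact: value_jvar.
Qed.

Lemma value_frame_jet : hess_det t != 0 ->
  forall i j, val (frame_jet th i j) (frame_jet t i j).
Proof.
move=> h; apply: value_framed => [||i j]; last exact: value_jvar.
  exact: value_frame1.
exact: value_frame2.
Qed.

End Values.

(** A point of the section where I_1, I_2b and I'_2b all equal 1; it witnesses that these rational
    functions are nonzero. *)
Definition base_jet : jetvar -> R := section_eval (fun _ => 1).

Lemma base_jetE : [/\ hess_det base_jet = 1, euler_det base_jet = 1 &
   frame_jet base_jet 0 2 = 1].
Proof.
have [//|//||-> -> ->] := @frame_jet_section R (fun i j => base_jet (Ju i j)).
  exact: oner_neq0.
by [].
Qed.

Lemma hess_det_neq0 : hess_det th != 0.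
Proof.
by have := value_neq0 (value_hess_det idfun base_jet); apply;
  have [-> _ _] := base_jetE; apply: oner_neq0.
Qed.

Lemma euler_det_neq0 : euler_det th != 0.
Proof.
by have := value_neq0 (value_euler_det idfun base_jet); apply;
  have [_ -> _] := base_jetE; apply: oner_neq0.
Qed.

Lemma frame_jet02E : frame_jet th 0 2 = I2b' R.
Proof. by rewrite frame_jet02 // hess_det_neq0. Qed.

Lemma I2b'_neq0 : I2b' R != 0.
Proof.
rewrite -frame_jet02E; apply: (@value_neq0 _ _ (poly_eval idfun base_jet)).
  by apply: value_frame_jet; have [-> _ _] := base_jetE; apply: oner_neq0.
by have [_ _ ->] := base_jetE; apply: oner_neq0.
Qed.

Lemma jvar_Dx :
  [/\ Dx (th Jx) = 1, Dx (th Jy) = 0 & forall i j, Dx (th (Ju i j)) = th (Ju i.+1 j)].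
Proof.
split=> [||i j]; rewrite Dx_jvar; [exact: rmorph1 | exact: rmorph0 | by []].
Qed.

Lemma jvar_Dy :
  [/\ Dy (th Jx) = 0, Dy (th Jy) = 1 & forall i j, Dy (th (Ju i j)) = th (Ju i j.+1)].
Proof.
split=> [||i j]; rewrite Dy_jvar; [exact: rmorph0 | exact: rmorph1 | by []].
Qed.

Lemma two_neq0 : 2 != 0 :> K.
Proof. by rewrite -(rmorph_nat (@jet_const R)) fmorph_eq0 pnatr_eq0. Qed.

Lemma jet_relations :
  [/\ rel1 (@nabla2' R) (I0 R) = 0,
      rel2 (@nabla1 R) (@nabla2' R) (I0 R) = 0,
      (forall f, rel3 (@nabla1 R) (@nabla2' R) (I0 R) f = 0) &
      rel4 (@nabla1 R) (@nabla2' R) (I0 R) (I2b' R) = 0].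
Proof.
have [dxx dxy dxu] := jvar_Dx; have [dyx dyy dyu] := jvar_Dy.
have [r1 r2 r3 r4] := frame_relations Dx_derivation Dy_derivation DxDy
  dxx dxy dyx dyy dxu dyu hess_det_neq0 euler_det_neq0.
rewrite nabla1_along nabla2_along -frame_jet02E; split=> //; apply: r4.
  by rewrite frame_jet02E I2b'_neq0.
exact: two_neq0.
Qed.

Lemma frame_jet_normal_jet i j :
  frame_jet th i j = normal_jet (@nabla1 R) (@nabla2' R) (I0 R) (I2b' R) i j.
Proof.
have [dxx dxy dxu] := jvar_Dx; have [dyx dyy dyu] := jvar_Dy.
rewrite nabla1_along nabla2_along -frame_jet02E.
exact: (frame_jet_normal Dx_derivation Dy_derivation
  dxx dxy dyx dyy dxu dyu hess_det_neq0 euler_det_neq0).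
Qed.

Lemma nabla1_derivation : derivation (@nabla1 R).
Proof.
by rewrite nabla1_along; apply: along_derivation Dx_derivation Dy_derivation _.
Qed.

Lemma nabla2_derivation : derivation (@nabla2' R).
Proof.
by rewrite nabla2_along; apply: along_derivation Dx_derivation Dy_derivation _.
Qed.

Lemma nabla1_const c : nabla1 (jet_const c) = 0 :> K.
Proof. by rewrite nabla1_along; apply: along_const (Dx_const c) (Dy_const c). Qed.

Lemma nabla2_const c : nabla2' (jet_const c) = 0 :> K.
Proof. by rewrite nabla2_along; apply: along_const (Dx_const c) (Dy_const c). Qed.

Lemma I1_nabla1 : I1 R = nabla1 (I0 R).
Proof.
have [_ _ dxu] := jvar_Dx; have [_ _ dyu] := jvar_Dy.
exact/esym/(along_array dxu dyu v 0 0).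
Qed.

Lemma I2a_nabla1 : I2a R = nabla1 (I1 R) - I1 R.
Proof.
have n20 := frame_jet_normal_jet 2 0.
rewrite normal_jetS0 -(frame_jet_normal_jet 1 0) mul1r in n20.
exact: (etrans (esym (frame_jet20 th)) n20).
Qed.

(* The normalized jets are algebraically independent, but for J_01 = 0 and
   J_11 = -1: they restrict to the coordinates on the section. *)
Lemma frame_jet_independent (p : jetpoly R) :
  poly_eval (@jet_const R) (section_jet (frame_jet th)) p = 0 ->
  poly_eval (@jet_const R) (section_eval th) p = 0.
Proof.
move=> p0; set t := section_eval th.
have u10 : t (Ju 1 0) != 0.
  by apply: value_neq0 (value_jvar idfun (fun _ => 1) _) _; apply: oner_neq0.
have [ht _ Jt] := @frame_jet_section K (fun i j => t (Ju i j)) erefl erefl u10.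
(* At a jet of the section each J_ij evaluates to the coordinate itself, the constants 0 and -1
   included. *)
have vt z : value (poly_eval (@jet_const R) t)
    (section_jet (frame_jet th) z) (t z).
  apply: (value_section_jet (J' := fun i j => t (Ju i j))) => i j.
  by rewrite -[t _]Jt; apply: value_frame_jet; rewrite ht.
apply: (value_uniq (value_poly_eval (iota' := @jet_const R) p _ vt)) => [c|].
  exact: value_const.
by rewrite p0; apply: value0.
Qed.

End JetField.

(** * The action of the group *)

Section Equivariance.
Variables (A : fieldType) (h0 h1 : A * A) (t t' : jetvar -> A).

Let det := h0.1 * h1.2 - h1.1 * h0.2.

Hypothesis det0 : det != 0.
Hypothesis base_eq : frame1 t = lincomb h0 h1 (frame1 t').
Hypothesis array_eq : jet_array t' = framed h0 h1 (jet_array t).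

(** I_2b is only a relative invariant: v is equivariant, but the group preserves the symplectic form
    up to a factor, so the Hamiltonian vector picks up a determinant. Dividing by I_2b cancels
    it. *)
Fact hess_det_equiv : hess_det t' = det * hess_det t.
Proof.
rewrite /hess_det array_eq; move: base_eq => [-> ->].
move: (jet_array t) (t' Jx) (t' Jy) => u x y; rewrite /framed /op /= /det.
by move: h0 h1 => [a b] [c d] /=; ring.
Qed.

Hypothesis hess0 : hess_det t != 0.

Fact frame2_equiv : lincomb h0 h1 (frame2 t') = frame2 t.
Proof.
rewrite /lincomb /frame2 hess_det_equiv array_eq /framed /op /=.
move: (hess_det t) hess0 det0; rewrite /det => H H0.
move: h0 h1 (jet_array t) => [a b] [c d] u /= d0.
by congr (_, _); field; rewrite d0 H0.
Qed.

Fact frame_jet_equiv : frame_jet t' = frame_jet t.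
Proof. by rewrite /frame_jet array_eq framed_comp frame2_equiv -base_eq. Qed.

End Equivariance.

Section ConstantFrames.
Variables (F : fieldType) (Dx Dy : F -> F) (u : nat -> nat -> F).
Hypotheses (DxP : derivation Dx) (DyP : derivation Dy).
Hypothesis along_u : forall e k l, along Dx Dy e (u k l) = op e u k l.
Local Notation along := (along Dx Dy).

Lemma along_op (c : F * F) (f : nat -> nat -> F) :
  (forall e, along e c.1 = 0) -> (forall e, along e c.2 = 0) ->
  (forall e k l, along e (f k l) = op e f k l) ->
  forall e k l, along e (op c f k l) = op e (op c f) k l.
Proof.
move=> c1 c2 uf e k l; have eP := along_derivation DxP DyP e.
rewrite (der_op eP) c1 c2 op_comm {1}/op /= !mul0r !add0r.
by rewrite /op !uf.
Qed.

Variables c0 c1 : F * F.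
Hypotheses (c01 : forall e, along e c0.1 = 0) (c02 : forall e, along e c0.2 = 0).
Hypotheses (c11 : forall e, along e c1.1 = 0) (c12 : forall e, along e c1.2 = 0).

Lemma along_iter_op i j e k l :
  along e (iter i (op c0) (iter j (op c1) u) k l) =
  op e (iter i (op c0) (iter j (op c1) u)) k l.
Proof.
elim: i e k l => [|i IHi] /=; last by apply: along_op.
by elim: j => [|j IHj] //=; apply: along_op.
Qed.

Lemma along_framed0 i j : along c0 (framed c0 c1 u i j) = framed c0 c1 u i.+1 j.
Proof. exact: along_iter_op. Qed.

Lemma along_framed1 i j : along c1 (framed c0 c1 u i j) = framed c0 c1 u i j.+1.
Proof. by rewrite /framed along_iter_op /= iter_op_comm. Qed.

(** No derivative falls on constant coefficients, so iterated total derivatives reduce to the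
    algebraic [framed]. This turns the recursive definition of [prolong] into [act_jet]. *)
Lemma iter_along_framed i j :
  iter i (along c0) (iter j (along c1) (u 0%N 0%N)) = framed c0 c1 u i j.
Proof.
elim: i => [|i /= ->]; last exact: along_framed0.
by elim: j => //= j ->; apply: (along_framed1 0).
Qed.

Lemma along_lincomb e f :
  along (lincomb c0 c1 e) f = e.1 * along c0 f + e.2 * along c1 f.
Proof. by rewrite /along /lincomb /=; ring. Qed.

End ConstantFrames.

Lemma mulmx2E (A : pzRingType) m n (g : 'M[A]_(m, 2)) (h : 'M[A]_(2, n)) i k :
  (g *m h) i k = g i 0 * h 0 k + g i 1 * h 1 k.
Proof.
rewrite mxE !big_ord_recl big_ord0 addr0.
by congr (_ + g i _ * h _ k); apply: val_inj.
Qed.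

Lemma det2E (A : comPzRingType) (g : 'M[A]_2) :
  \det g = g 0 0 * g 1 1 - g 0 1 * g 1 0.
Proof.
rewrite (expand_det_row _ 0) !big_ord_recl big_ord0 addr0 /cofactor !det_mx11 !mxE.
rewrite /= expr0 expr1 mul1r mulN1r mulrN.
by congr (g _ _ * g _ _ - g _ _ * g _ _); apply: val_inj.
Qed.

Section GroupAction.
Variable R : realType.
Local Notation K := (jetfield R).
Local Notation th := (jvar R).
Implicit Types g h : 'M[R]_2.

Section Act.
Variables (A : fieldType) (iota : {rmorphism R -> A}).

Definition iota_col h k : A * A := (iota (h 0 k), iota (h 1 k)).

Definition act_jet g (t : jetvar -> A) (z : jetvar) : A :=
  match z with
  | Jx => (lincomb (iota_col g 0) (iota_col g 1) (frame1 t)).1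
  | Jy => (lincomb (iota_col g 0) (iota_col g 1) (frame1 t)).2
  | Ju i j => framed (iota_col (invmx g) 0) (iota_col (invmx g) 1) (jet_array t) i j
  end.

Lemma frame1_act g t :
  frame1 (act_jet g t) = lincomb (iota_col g 0) (iota_col g 1) (frame1 t).
Proof. by rewrite /frame1 /=. Qed.

Lemma lincomb_mul g h e :
  lincomb (iota_col g 0) (iota_col g 1) (lincomb (iota_col h 0) (iota_col h 1) e) =
  lincomb (iota_col (g *m h) 0) (iota_col (g *m h) 1) e.
Proof.
rewrite /lincomb /iota_col /= !mulmx2E !rmorphD !rmorphM.
by congr (_, _); ring.
Qed.

Lemma iota_col1 : iota_col 1%:M 0 = (1, 0) /\ iota_col 1%:M 1 = (0, 1).
Proof. by rewrite /iota_col !mxE /= rmorph1 rmorph0. Qed.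

Lemma lincomb_invl g e : g \in unitmx ->
  lincomb (iota_col (invmx g) 0) (iota_col (invmx g) 1)
    (lincomb (iota_col g 0) (iota_col g 1) e) = e.
Proof.
move=> gU; rewrite lincomb_mul mulVmx //; have [-> ->] := iota_col1.
by case: e => a b; rewrite /lincomb /=; congr (_, _); ring.
Qed.

Lemma col_lincomb g h k :
  lincomb (iota_col g 0) (iota_col g 1) (iota_col h k) = iota_col (g *m h) k.
Proof.
rewrite /lincomb /iota_col /= !mulmx2E !rmorphD !rmorphM.
by congr (_, _); ring.
Qed.

Lemma jet_array_act g t : jet_array (act_jet g t) =
  framed (iota_col (invmx g) 0) (iota_col (invmx g) 1) (jet_array t).
Proof. by []. Qed.

Lemma act_invK g t : g \in unitmx -> act_jet (invmx g) (act_jet g t) = t.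
Proof.
move=> gU; apply: funext => -[||i j].
- exact: (congr1 (@fst A A) (lincomb_invl (frame1 t) gU)).
- exact: (congr1 (@snd A A) (lincomb_invl (frame1 t) gU)).
rewrite /= jet_array_act framed_comp invmxK !col_lincomb mulVmx //.
by have [-> ->] := iota_col1; rewrite framed_id.
Qed.

Lemma act_Kinv g t : g \in unitmx -> act_jet g (act_jet (invmx g) t) = t.
Proof. by move=> gU; rewrite -{1}[g]invmxK act_invK ?unitmx_inv. Qed.

Lemma act_det g : g \in unitmx ->
  (iota_col (invmx g) 0).1 * (iota_col (invmx g) 1).2
  - (iota_col (invmx g) 1).1 * (iota_col (invmx g) 0).2 != 0.
Proof.
move=> gU; rewrite /= -!rmorphM -rmorphB fmorph_eq0.
have := unitmx_inv g; rewrite gU unitmxE det2E unitfE.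
by congr (_ - _ != 0); rewrite mulrC.
Qed.

Lemma act_equiv g t : g \in unitmx -> hess_det t != 0 ->
  lincomb (iota_col (invmx g) 0) (iota_col (invmx g) 1) (frame1 (act_jet g t))
    = frame1 t /\
  lincomb (iota_col (invmx g) 0) (iota_col (invmx g) 1) (frame2 (act_jet g t))
    = frame2 t /\
  frame_jet (act_jet g t) = frame_jet t /\ hess_det (act_jet g t) != 0.
Proof.
move=> gU hn0; have dn0 := act_det gU.
have e1 : lincomb (iota_col (invmx g) 0) (iota_col (invmx g) 1)
    (frame1 (act_jet g t)) = frame1 t.
  by rewrite frame1_act lincomb_invl.
split=> //; split; [|split].
- exact: (frame2_equiv dn0 (esym e1) (jet_array_act g t) hn0).
- exact: (frame_jet_equiv dn0 (esym e1) (jet_array_act g t) hn0).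
- by rewrite (hess_det_equiv (esym e1) (jet_array_act g t)) mulf_neq0.
Qed.

End Act.

Lemma along_jvar e k l :
  along (@Dx R) (@Dy R) e (jet_array th k l) = op e (jet_array th) k l.
Proof.
have [_ _ dxu] := jvar_Dx R; have [_ _ dyu] := jvar_Dy R.
exact: (along_array dxu dyu).
Qed.

Lemma along_jet_const e c : along (@Dx R) (@Dy R) e (jet_const c) = 0.
Proof. exact: along_const (Dx_const c) (Dy_const c). Qed.

Local Notation kcol := (iota_col (@jet_const R)).

Lemma prolong_tofrac g z : (prolong g z)%:F = act_jet (@jet_const R) g th z.
Proof.
have scaleF c (p : jetpoly R) : (c *: p)%:F = jet_const c * p%:F :> K.
  by rewrite -mul_malgC tofracM.
have linF c c' (p q : jetpoly R) :
    (c *: p + c' *: q)%:F = jet_const c * p%:F + jet_const c' * q%:F :> K.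
  exact: (etrans (tofracD _ _) (congr2 +%R (scaleF c p) (scaleF c' q))).
case: z => [||i j].
- exact: (etrans (linF (g 0 0) (g 0 1) (var R Jx) (var R Jy))
    (congr2 +%R (mulrC (jet_const _) (th Jx)) (mulrC (jet_const _) (th Jy)))).
- exact: (etrans (linF (g 1 0) (g 1 1) (var R Jx) (var R Jy))
    (congr2 +%R (mulrC (jet_const _) (th Jx)) (mulrC (jet_const _) (th Jy)))).
rewrite [RHS]/= -(iter_along_framed (Dx_derivation R) (Dy_derivation R) along_jvar);
  try by move=> e; apply: along_jet_const.
pose D (k : 'I_2) (p : jetpoly R) : jetpoly R :=
  invmx g 0 k *: poly_der (total_x R) p + invmx g 1 k *: poly_der (total_y R) p.
rewrite -[LHS]/((iter i (D 0) (iter j (D 1) (var R (Ju 0 0))))%:F).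
have DF k (p : jetpoly R) : (D k p)%:F = along (@Dx R) (@Dy R) (kcol (invmx g) k) p%:F.
  apply: (etrans (linF (invmx g 0 k) (invmx g 1 k)
    (poly_der (total_x R) p) (poly_der (total_y R) p))).
  exact: (congr2 (fun a b : K => jet_const _ * a + jet_const _ * b)
    (esym (frac_der_tofrac (total_x R) p)) (esym (frac_der_tofrac (total_y R) p))).
have iterD k n p : (iter n (D k) p)%:F =
    iter n (along (@Dx R) (@Dy R) (kcol (invmx g) k)) p%:F.
  elim: n => [|n IHn]; first by [].
  exact: (etrans (DF k (iter n (D k) p)) (congr1 _ IHn)).
exact: (etrans (iterD 0 i _) (congr1 _ (iterD 1 j _))).
Qed.

End GroupAction.

Fact der_affine (F : fieldType) (d : F -> F) (dP : derivation d) (x y a b k l : F) :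
  d k = 0 -> d l = 0 -> d x = a -> d y = b -> d (x * k + y * l) = a * k + b * l.
Proof. by move=> dk dl <- <-; rewrite (derD dP) !(derM dP) dk dl !mulr0 !addr0. Qed.

(** * Pullback of rational functions by group elements *)

Section Pullback.
Variable R : realType.
Local Notation K := (jetfield R).
Local Notation th := (jvar R).
Local Notation jc := (@jet_const R).
Implicit Types g h : 'M[R]_2.

Lemma value_act (A : fieldType) (iota : {rmorphism R -> A}) (t : jetvar -> A) g z :
  value (poly_eval iota t) (act_jet jc g th z) (act_jet iota g t z).
Proof.
have vc c : value (poly_eval iota t) (jc c) (iota c) by exact: value_const.
have vj k : value (poly_eval iota t) (th k) (t k) by exact: value_jvar.
case: z => [||i j].
- exact: (valueD (valueM (vj Jx) (vc (g 0 0))) (valueM (vj Jy) (vc (g 0 1)))).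
- exact: (valueD (valueM (vj Jx) (vc (g 1 0))) (valueM (vj Jy) (vc (g 1 1)))).
- by apply: value_framed => [||k l]; [split; exact: vc | split; exact: vc | exact: vj].
Qed.

Lemma eval_prolong (A : fieldType) (iota : {rmorphism R -> A}) (t : jetvar -> A) g z :
  poly_eval iota t (prolong g z) = act_jet iota g t z.
Proof.
have := value_tofrac (poly_eval iota t) (prolong g z).
by rewrite prolong_tofrac => /value_uniq; apply; apply: value_act.
Qed.

Lemma poly_eval_jvar (p : jetpoly R) : poly_eval jc th p = p%:F.
Proof.
elim/ipoly_ind: p => [c|i|p q IHp IHq|p q IHp IHq].
- exact: poly_evalC.
- exact: poly_evalX.
- exact: (etrans (rmorphD _ p q) (etrans (congr2 +%R IHp IHq) (esym (tofracD p q)))).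
- exact: (etrans (rmorphM _ p q) (etrans (congr2 *%R IHp IHq) (esym (tofracM p q)))).
Qed.

Lemma pullbackE g : pullback g = frac_eval jc (act_jet jc g th).
Proof.
rewrite /pullback; congr frac_eval; apply: funext => z; exact: prolong_tofrac.
Qed.

Section Invertible.
Variable g : 'M[R]_2.
Hypothesis gU : g \in unitmx.

Local Notation t := (act_jet jc g th).
Local Notation val := (value (poly_eval jc t)).

(** Evaluating back at the jet moved by [invmx g] returns [p]. Hence no denominator vanishes under
    the substitution, and [pullback g] does not depend on representatives. *)
Lemma act_eval_inj (p : jetpoly R) : poly_eval jc t p = 0 -> p = 0.
Proof.
move=> p0; apply/eqP; rewrite -tofrac_eq0 -poly_eval_jvar; apply/eqP.
pose t' := act_jet jc (invmx g) th.
have vt z : value (poly_eval jc t') (t z) (th z).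
  by have := value_act jc t' g z; rewrite /t' act_Kinv.
have := value_poly_eval (iota' := jc) p (@value_const _ _ jc t') vt.
by rewrite p0 => /value_uniq/(_ (value0 _)).
Qed.

Lemma value_pullback f : val f (pullback g f).
Proof. rewrite pullbackE; exact: value_total act_eval_inj f. Qed.

Lemma pullback_uniq f c : val f c -> pullback g f = c.
Proof. exact: value_uniq (value_pullback f). Qed.

Lemma pullbackD f f' : pullback g (f + f') = pullback g f + pullback g f'.
Proof. by apply: pullback_uniq; apply: valueD; apply: value_pullback. Qed.

Lemma pullbackM f f' : pullback g (f * f') = pullback g f * pullback g f'.
Proof. by apply: pullback_uniq; apply: valueM; apply: value_pullback. Qed.

Lemma pullback_poly_eval (I : choiceType) (v : I -> K) (p : ipoly R I) :
  (forall i, pullback g (v i) = v i) ->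
  pullback g (poly_eval jc v p) = poly_eval jc v p.
Proof.
move=> vg; apply: pullback_uniq; apply: value_poly_eval => [c|i].
  exact: value_const.
by rewrite -{2}(vg i); apply: value_pullback.
Qed.

Lemma pullback_div f f' : f' != 0 -> pullback g f = f -> pullback g f' = f' ->
  pullback g (f / f') = f / f'.
Proof.
move=> f'0 e e'; apply: pullback_uniq; apply: value_div => //.
  by rewrite -{2}e; apply: value_pullback.
by rewrite -{2}e'; apply: value_pullback.
Qed.

Lemma hess_det_act : hess_det t != 0.
Proof. by have [_ [_ [_ ]]] := act_equiv jc gU (hess_det_neq0 R). Qed.

Lemma pullback_frame_jet i j : pullback g (frame_jet th i j) = frame_jet th i j.
Proof.
have [_ [_ [e _]]] := act_equiv jc gU (hess_det_neq0 R).
by apply: pullback_uniq; rewrite -{2}e; apply/value_frame_jet/hess_det_act.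
Qed.

Local Notation c0 := (iota_col jc (invmx g) 0).
Local Notation c1 := (iota_col jc (invmx g) 1).
Local Notation along := (along (@Dx R) (@Dy R)).

Lemma along_act c z : along c (t z) =
  match z with
  | Jx => (lincomb (iota_col jc g 0) (iota_col jc g 1) c).1
  | Jy => (lincomb (iota_col jc g 0) (iota_col jc g 1) c).2
  | Ju i j => along c (t (Ju i j))
  end.
Proof.
have [dxx dxy _] := jvar_Dx R; have [dyx dyy _] := jvar_Dy R.
have cP := along_derivation (Dx_derivation R) (Dy_derivation R) c.
have f1 := along_frame1 dxx dxy dyx dyy c.
have := congr1 (@fst K K) f1; have := congr1 (@snd K K) f1 => /= f12 f11.
have ck (a : R) : along c (jc a) = 0 by exact: along_jet_const.
case: z => [||i j]; last by [].
- exact: (der_affine cP (ck (g 0 0)) (ck (g 0 1)) f11 f12).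
- exact: (der_affine cP (ck (g 1 0)) (ck (g 1 1)) f11 f12).
Qed.

Let DxP := Dx_derivation R.
Let DyP := Dy_derivation R.

Lemma pullback_Dx f : pullback g (Dx f) = along c0 (pullback g f).
Proof.
have dP := along_derivation DxP DyP c0.
apply: pullback_uniq; apply: (value_frac_der dP) (value_pullback f) => p.
apply: (eval_poly_der _ dP) => [c|z]; first exact: along_jet_const.
rewrite along_act col_lincomb mulmxV //; have [-> _] := iota_col1 jc.
case: z => [||i j] /=.
- by rewrite rmorph1.
- by rewrite rmorph0.
rewrite (along_framed0 DxP DyP (@along_jvar R)); try by move=> e; exact: along_jet_const.
by rewrite poly_evalX.
Qed.

Lemma pullback_Dy f : pullback g (Dy f) = along c1 (pullback g f).
Proof.
have dP := along_derivation DxP DyP c1.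
apply: pullback_uniq; apply: (value_frac_der dP) (value_pullback f) => p.
apply: (eval_poly_der _ dP) => [c|z]; first exact: along_jet_const.
rewrite along_act col_lincomb mulmxV //; have [_ ->] := iota_col1 jc.
case: z => [||i j] /=.
- by rewrite rmorph0.
- by rewrite rmorph1.
rewrite (along_framed1 DxP DyP (@along_jvar R)); try by move=> e; exact: along_jet_const.
by rewrite poly_evalX.
Qed.

(** [e'] is [e] read at the transformed jet; the condition says that the inverse matrix carries it
    back to [e], that is, that the vector field is equivariant. *)
Lemma pullback_along e e' f : value2 (poly_eval jc t) e e' ->
  lincomb c0 c1 e' = e -> pullback g (along e f) = along e (pullback g f).
Proof.
move=> [v1 v2] ee; apply: (etrans (pullbackD _ _)).
apply: (etrans (congr2 +%R
  (etrans (pullbackM _ _) (congr2 *%R (pullback_uniq v1) (pullback_Dx f)))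
  (etrans (pullbackM _ _) (congr2 *%R (pullback_uniq v2) (pullback_Dy f))))).
apply: (etrans (esym (along_lincomb _ _ _ _ e' _))).
exact: (congr1 (fun z => along z (pullback g f)) ee).
Qed.

Lemma pullback_nabla1 f : pullback g (nabla1 f) = nabla1 (pullback g f).
Proof.
have [e _] := act_equiv jc gU (hess_det_neq0 R).
by rewrite nabla1_along; apply: pullback_along (value_frame1 _ _) e.
Qed.

Lemma pullback_nabla2 f : pullback g (nabla2' f) = nabla2' (pullback g f).
Proof.
have [_ [e _]] := act_equiv jc gU (hess_det_neq0 R).
by rewrite nabla2_along; apply: pullback_along (value_frame2 _ hess_det_act) e.
Qed.

End Invertible.

Lemma omega_mulmx (A : 'M[R]_2) v w :
  omega (A *m v) (A *m w) = \det A * omega v w.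
Proof. by rewrite /omega !mulmx2E det2E; ring. Qed.

(** In dimension 2 a matrix multiplies [omega] by its determinant, so the symplectic matrices are
    those of determinant 1, and the homothety factor of [g] is the square root of [\det g]. *)
Lemma CSp2P g : CSp2 g <-> 0 < \det g.
Proof.
split=> [[A [s [AS s0 ->]]]|g0].
  have e := AS (delta_mx 0 0) (delta_mx 1 0); rewrite omega_mulmx in e.
  have o1 : omega (delta_mx 0 0 : 'cV[R]_2) (delta_mx 1 0) = 1.
    by rewrite /omega !mxE /=; ring.
  by rewrite detZ -[\det A]mulr1 -o1 e o1 mulr1 exprn_gt0.
have sg0 : 0 < Num.sqrt (\det g) by rewrite sqrtr_gt0.
exists ((Num.sqrt (\det g))^-1 *: g), (Num.sqrt (\det g)); split=> //.
  move=> v w; rewrite omega_mulmx detZ exprVn sqr_sqrtr ?ltW //.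
  by rewrite mulVf ?mul1r // gt_eqF.
by rewrite scalerA mulfV ?scale1r // gt_eqF.
Qed.

Lemma CSp2_unitmx g : CSp2 g -> g \in unitmx.
Proof. by move/CSp2P => g0; rewrite unitmxE unitfE gt_eqF. Qed.

Lemma nabla1_invariant : invariant_derivation (@nabla1 R).
Proof.
split; first by exists (th Jx), (th Jy).
by move=> g /CSp2_unitmx gU f; rewrite pullback_nabla1.
Qed.

Lemma nabla2_invariant : invariant_derivation (@nabla2' R).
Proof.
split; last by move=> g /CSp2_unitmx gU f; rewrite pullback_nabla2.
by exists (frame2 th).1, (frame2 th).2 => f; rewrite nabla2_along.
Qed.

Lemma jet_act_act g t : jet_act g t = act_jet idfun g t.
Proof. by apply: funext => z; apply: eval_prolong. Qed.

(** The value at the moved jet comes from some representation defined there. Its pullback by [g]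
    represents [f] again and is defined at [t], so both numbers are values of [f] at [t]. *)
Lemma pullback_fixed_invariant f :
  (forall g, g \in unitmx -> pullback g f = f) -> differential_invariant f.
Proof.
move=> fg g t c c' /CSp2_unitmx gU; rewrite jet_act_act => fc fc'.
suff : value (poly_eval idfun t) f c' by move/value_uniq; apply.
have := value_pullback gU f; rewrite fg // => /value_uniq _.
case: fc' => p [q [fE q0 ->]].
have ev r : value (poly_eval idfun t) (poly_eval jc (act_jet jc g th) r)
    (poly_eval idfun (act_jet idfun g t) r).
  apply: value_poly_eval => [a|z]; first exact: (value_const idfun).
  exact: value_act.
have := value_div (ev p) (ev q) q0; congr (value _ _ _).
rewrite -[RHS](fg g gU); apply/esym/(pullback_uniq gU); rewrite fE.
exists p, q; split=> //; apply: contraNneq q0 => e.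
by apply/eqP; apply: value_uniq (ev q) _; rewrite e; apply: value0.
Qed.

End Pullback.

(** * Invariants are determined on the section *)

Lemma poly_nonroot (A : idomainType) (f : nat -> A) (q : {poly A}) :
  injective f -> q != 0 -> exists n, q.[f n] != 0.
Proof.
move=> fI q0; apply: contrapT => no.
have roots : all (root q) (map f (iota 0 (size q))).
  apply/allP => _ /mapP[n _ ->]; apply/rootP/eqP; apply: contrapT => /negP.
  by move=> qn; apply: no; exists n.
have := max_poly_roots q0 roots; rewrite map_inj_uniq // iota_uniq => /(_ isT).
by rewrite size_map size_iota ltnn.
Qed.

Section Specialization.
Variables (R : realType) (I : choiceType).
Local Notation P := (ipoly R I).
Local Notation C := (@mkmalgU {cmonom I} R mone).

Lemma poly_eval_vars (A : comNzRingType) (iota : {rmorphism R -> A})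
    (v w : I -> A) (p : P) :
  {in vars p, v =1 w} -> poly_eval iota v p = poly_eval iota w p.
Proof.
move=> vw; rewrite /poly_eval /mmap.
apply: eq_big_seq => m mp; congr (_ * _); rewrite /monom_eval.
apply: eq_big_seq => i im; rewrite vw //.
by apply: mem_vars mp _; rewrite cmE_neq0.
Qed.

Lemma poly_eval_var (p : P) : poly_eval C (fun i => var R i) p = p.
Proof.
elim/ipoly_ind: p => [c|i|p q IHp IHq|p q IHp IHq].
- exact: poly_evalC.
- exact: poly_evalX.
- exact: (etrans (rmorphD _ p q) (congr2 +%R IHp IHq)).
- exact: (etrans (rmorphM _ p q) (congr2 *%R IHp IHq)).
Qed.

Fact natr_ipoly_inj : injective (fun n => n%:R%:MP : P).
Proof.
move=> m n e; apply/eqP; rewrite -(eqr_nat R); apply/eqP.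
exact: (can_inj (@malgCK {cmonom I} R) e).
Qed.

(** [p] is read as a univariate polynomial in the indeterminate [i] over [P] itself. Putting
    [var R i] back gives [p], so it is nonzero, and some natural number is not a root. *)
Lemma specialize_var (i : I) (p : P) : p != 0 -> exists a : R,
  poly_eval C (fun k => if k == i then a%:MP else var R k) p != 0.
Proof.
move=> p0; pose iotaX := @polyC P \o C.
pose q : {poly P} := poly_eval iotaX (fun k => if k == i then 'X else (var R k)%:P) p.
have qE (c : P) : q.[c] = poly_eval C (fun k => if k == i then c else var R k) p.
  rewrite -/(horner_eval c q) (poly_eval_comp (iota' := C)) => [|a].
    by apply: poly_eval_ext => k; case: (k =P i) => _; [exact: hornerX | exact: hornerC].
  exact: hornerC.
have q0 : q != 0.
  apply: contraNneq p0 => q0; have := qE (var R i); rewrite q0 horner0 => e.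
  rewrite -[p]poly_eval_var e; apply/eqP/poly_eval_ext => k.
  by case: eqP => [->|].
have [n qn] := poly_nonroot natr_ipoly_inj q0.
by exists n%:R; rewrite -qE.
Qed.

Lemma specialize_vars (s : seq I) (p : P) : p != 0 -> exists t : I -> R,
  poly_eval C (fun k => if k \in s then (t k)%:MP else var R k) p != 0.
Proof.
elim: s p => [|i s IHs] p p0.
  by exists (fun=> 0); rewrite poly_eval_var.
have [a pa] := specialize_var i p0; have [t pt] := IHs _ pa.
exists (fun k => if k == i then a else t k).
pose h := poly_eval C (fun k => if k \in s then (t k)%:MP else var R k).
pose v1 k : P := if k == i then a%:MP else var R k.
pose v2 k : P := if k \in i :: s then (if k == i then a else t k)%:MP else var R k.
have hv k : h (v1 k) = v2 k.
  rewrite /v1 /v2 inE; case: eqP => _ /=; first exact: poly_evalC.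
  exact: poly_evalX.
have e : poly_eval C v2 p = h (poly_eval C v1 p).
  apply: (etrans (esym (poly_eval_ext C p hv))).
  exact: (esym (poly_eval_comp (iota' := C) v1 p (@poly_evalC _ _ _ _ _))).
exact: (eq_ind_r (fun z : P => z != 0) pt e).
Qed.

Lemma nonvanishing_point (p : P) : p != 0 -> exists t : I -> R,
  poly_eval idfun t p != 0.
Proof.
move=> p0; have [t pt] := specialize_vars (vars p) p0; exists t.
apply: contraNneq pt => e; apply/eqP.
rewrite (@poly_eval_vars _ _ _ (fun k => (t k)%:MP)) => [|k ->] //.
apply: (etrans (esym (poly_eval_comp (iota := idfun) (iota' := C) (h := C)
  t p (fun=> erefl)))).
exact: (etrans (congr1 C e) malgC0E).
Qed.

End Specialization.

Fact morph_prod_neq0 (P : comPzRingType) (A : idomainType)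
    (h : {rmorphism P -> A}) (a b c d : P) :
  h (a * (b * (c * d))) != 0 ->
  [/\ h a != 0, h b != 0, h c != 0 & h d != 0].
Proof. by rewrite !rmorphM !mulf_eq0 !negb_or => /and4P. Qed.

(** * Zariski density of the positively oriented jets *)

Section Density.
Variable R : realType.
Local Notation K := (jetfield R).
Local Notation th := (jvar R).
Local Notation jc := (@jet_const R).
Local Notation J := (frame_jet th).

Definition upd (t : jetvar -> R) (a : R) : jetvar -> R :=
  fun z => if z == Ju 2 0 then a else t z.

Lemma euler_det_upd t a : euler_det (upd t a) = euler_det t.
Proof. by []. Qed.

Lemma hess_det_upd t a :
  hess_det (upd t a) = hess_det t + t Jx * t (Ju 0 1) * (a - t (Ju 2 0)).
Proof. by rewrite /hess_det /jet_array /upd /=; ring. Qed.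

(* Where the frame is positively oriented, g = (v w) lies in the group. The
   positivity is removed by letting u_xx, on which the determinant depends
   linearly, run through a sequence. *)
Lemma positive_frame_point (p : jetpoly R) : p != 0 -> exists t : jetvar -> R,
  0 < euler_det t * hess_det t /\ poly_eval idfun t p != 0.
Proof.
move=> p0.
pose eP : jetpoly R := var R Jx * var R (Ju 1 0) + var R Jy * var R (Ju 0 1).
have ePE t : poly_eval idfun t eP = euler_det t.
  apply: (etrans (rmorphD _ _ _)).
  by apply: (congr2 +%R); apply: (etrans (rmorphM _ _ _));
    apply: (congr2 *%R); exact: poly_evalX.
have eP0 : eP != 0.
  have := base_jetE R; case=> _ e _; rewrite -ePE in e.
  have e0 : poly_eval idfun (base_jet R) eP != 0 by rewrite e oner_neq0.
  exact: (ev_neq0 e0).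
have var0 z : var R z != 0 :> jetpoly R.
  have v0 : poly_eval idfun (fun=> 1 : R) (var R z) != 0.
    by rewrite poly_evalX oner_neq0.
  exact: (ev_neq0 v0).
(* The extra factors keep I_1 nonzero at the chosen point, as well as x u_y, the coefficient of u_xx
   in I_2b. *)
have prod0 : p * (eP * (var R Jx * var R (Ju 0 1))) != 0.
  by apply: mulf_neq0 => //; apply: mulf_neq0 => //; apply: mulf_neq0.
have [t /morph_prod_neq0[pt et xt ut]] := nonvanishing_point prod0.
have {}et : euler_det t != 0 by rewrite -ePE; exact: et.
have {}xt : t Jx != 0 by rewrite -[t Jx](poly_evalX idfun t Jx); exact: xt.
have {}ut : t (Ju 0 1) != 0.
  by rewrite -[t _](poly_evalX idfun t (Ju 0 1)); exact: ut.
pose q : {poly R} := poly_eval (@polyC R)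
  (fun z => if z == Ju 2 0 then 'X else (t z)%:P) p.
have qE a : q.[a] = poly_eval idfun (upd t a) p.
  rewrite -/(horner_eval a q) (poly_eval_comp (iota' := idfun)) => [|b].
    apply: poly_eval_ext => z; rewrite /upd.
    by case: (z == _); [exact: hornerX | exact: hornerC].
  exact: hornerC.
have q0 : q != 0.
  apply: contraNneq pt => e; have := qE (t (Ju 2 0)); rewrite e horner0 => e'.
  rewrite e'; apply/eqP/poly_eval_ext => z; rewrite /upd.
  by case: eqP => [->|].
(* The value of u_xx at which I_2b equals [n.+1] times I_1; the product of the two is then a
   positive multiple of a nonzero square. *)
pose f n := t (Ju 2 0) + (euler_det t * n.+1%:R - hess_det t) / (t Jx * t (Ju 0 1)).
have fI : injective f.
  move=> m n /addrI/(mulIf _) -/(_ _)/addIr/(mulfI et) e.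
  have {}e := e (invr_neq0 (mulf_neq0 xt ut)).
  by apply/eqP; rewrite -eqSS -(eqr_nat R); apply/eqP.
have [n qn] := poly_nonroot fI q0; exists (upd t (f n)); split.
  rewrite euler_det_upd hess_det_upd.
  have -> : hess_det t + t Jx * t (Ju 0 1) * (f n - t (Ju 2 0)) =
      euler_det t * n.+1%:R.
    by rewrite /f; move: (hess_det t) (euler_det t) (n.+1%:R) => a b c;
      field; rewrite xt ut.
  rewrite mulrA mulr_gt0 ?ltr0Sn // -expr2 exprn_even_gt0 //=.
by rewrite -qE.
Qed.

Lemma vanish_positive_frame (p : jetpoly R) :
  (forall t, 0 < euler_det t * hess_det t -> poly_eval idfun t p = 0) -> p = 0.
Proof.
move=> pv; apply/eqP; apply: contraT => /positive_frame_point[t [tpos]].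
by rewrite pv // eqxx.
Qed.

Definition frame_mx (t : jetvar -> R) : 'M[R]_2 :=
  \matrix_(i, j) let e := if j == 0 then frame1 t else frame2 t in
    if i == 0 then e.1 else e.2.

Lemma frame_mx_col t : iota_col idfun (frame_mx t) 0 = frame1 t /\
  iota_col idfun (frame_mx t) 1 = frame2 t.
Proof. by rewrite /iota_col !mxE. Qed.

Lemma frame_mx_CSp2 t : 0 < euler_det t * hess_det t -> CSp2 (frame_mx t).
Proof.
move=> tpos; apply/CSp2P; rewrite det2E !mxE /=.
have h0 : hess_det t != 0 by apply: contraTneq tpos => ->; rewrite mulr0 ltxx.
have -> : forall a b c d : R, a * b - c * d = a * b - d * c by move=> *; ring.
have := frame_det h0 => /= ->.
have -> : euler_det t / hess_det t = euler_det t * hess_det t / hess_det t ^+ 2.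
  by move: h0; move: (euler_det t) (hess_det t) => a b b0; field.
by rewrite divr_gt0 // exprn_even_gt0.
Qed.

Lemma normalize_jet t : hess_det t != 0 -> frame_mx t \in unitmx ->
  act_jet idfun (invmx (frame_mx t)) t = section_jet (frame_jet t).
Proof.
move=> h0 MU; have [c0 c1] := frame_mx_col t.
have e1 : lincomb (iota_col idfun (invmx (frame_mx t)) 0)
    (iota_col idfun (invmx (frame_mx t)) 1) (frame1 t) = (1, 0).
  rewrite -c0 col_lincomb mulVmx //.
  by have [] := iota_col1 (idfun : {rmorphism R -> R}).
apply: funext => -[||i j].
- exact: (congr1 (@fst R R) e1).
- exact: (congr1 (@snd R R) e1).
- by rewrite /act_jet invmxK c0 c1.
Qed.

Lemma has_value_frac (p q : jetpoly R) t : poly_eval idfun t q != 0 ->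
  has_value (p%:F / q%:F) t (poly_eval idfun t p / poly_eval idfun t q).
Proof. by move=> q0; exists p, q. Qed.

Definition act_poly (g : 'M[R]_2) (p : jetpoly R) : jetpoly R :=
  poly_eval (@mkmalgU {cmonom jetvar} R mone) (prolong g) p.

Lemma eval_act_poly g p t :
  poly_eval idfun t (act_poly g p) = poly_eval idfun (act_jet idfun g t) p.
Proof.
apply: (etrans (poly_eval_comp (iota' := idfun) (prolong g) p _)) => [c|].
  exact: poly_evalC.
by apply: poly_eval_ext => z; apply: eval_prolong.
Qed.

Lemma act_poly_neq0 g (q : jetpoly R) : g \in unitmx -> q != 0 -> act_poly g q != 0.
Proof.
move=> gU /nonvanishing_point[t qt].
have e : poly_eval idfun (act_jet idfun (invmx g) t) (act_poly g q) != 0.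
  by rewrite eval_act_poly act_Kinv.
exact: (ev_neq0 e).
Qed.

(** The factor [b * d] absorbs the points where a denominator vanishes, so the product is zero at
    every point and density applies. *)
Fact cross_vanish (P A : idomainType) (h : {rmorphism P -> A}) (a b c d : P) :
  (h b != 0 -> h d != 0 -> h a * h d = h c * h b) ->
  h ((a * d - c * b) * (b * d)) = 0.
Proof.
move=> e; rewrite rmorphM rmorphB !rmorphM.
have [->|b0] := eqVneq (h b) 0; first by rewrite mul0r mulr0.
have [->|d0] := eqVneq (h d) 0; first by rewrite !mulr0.
by rewrite e // subrr mul0r.
Qed.

Fact cross_eq (P : idomainType) (a b c d : P) : b != 0 -> d != 0 ->
  (a * d - c * b) * (b * d) = 0 -> a%:F / b%:F = c%:F / d%:F :> {fraction P}.
Proof.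
move=> b0 d0 /eqP; rewrite mulf_eq0 (negPf (mulf_neq0 b0 d0)) orbF subr_eq0.
by rewrite -frac_eq // => /eqP.
Qed.

(** Turns pointwise invariance into an identity of fractions: the cross-multiplied difference
    vanishes at all real jets, hence is the zero polynomial. *)
Lemma invariant_act_poly (p q : jetpoly R) g : CSp2 g -> q != 0 ->
  differential_invariant (p%:F / q%:F) ->
  p%:F / q%:F = (act_poly g p)%:F / (act_poly g q)%:F :> K.
Proof.
move=> gG q0 inv; have gU := CSp2_unitmx gG.
have qg0 := act_poly_neq0 gU q0; apply: (cross_eq q0 qg0).
apply/eqP; apply: contraT => /nonvanishing_point[t /negP[]]; apply/eqP.
have key b d : b = poly_eval idfun (act_jet idfun g t) p ->
    d = poly_eval idfun (act_jet idfun g t) q ->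
    poly_eval idfun t q != 0 -> d != 0 ->
    poly_eval idfun t p * d = b * poly_eval idfun t q.
  move=> -> -> qt qgt.
  have := inv g t _ _ gG (has_value_frac p qt).
  rewrite jet_act_act => /(_ _ (has_value_frac p qgt)) /eqP.
  by rewrite eqr_div // => /eqP ->.
exact: (cross_vanish (key _ _ (eval_act_poly g p t) (eval_act_poly g q t))).
Qed.

(* An invariant is determined by its restriction to the section, where it is
   evaluated at the coordinates J_ij of the jet in the invariant frame. The
   representative is chosen so that its denominator does not vanish there. *)
Lemma invariant_on_section (f : K) : differential_invariant f ->
  exists p q : jetpoly R,
    poly_eval jc (section_jet J) q != 0 /\
    f = poly_eval jc (section_jet J) p / poly_eval jc (section_jet J) q.
Proof.
elim/frac_ind: f => p0 q0 q00 inv.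
have [t0 [t0pos q0t0]] := positive_frame_point q00.
have hess_pos (t : jetvar -> R) : 0 < euler_det t * hess_det t -> hess_det t != 0.
  by move=> tpos; apply: contraTneq tpos => ->; rewrite mulr0 ltxx.
have MU t : 0 < euler_det t * hess_det t -> frame_mx t \in unitmx.
  by move=> tpos; apply/CSp2_unitmx/frame_mx_CSp2.
(* The translate by [frame_mx t0] is the same fraction by invariance, and its denominator at the
   normalized jet of [t0] equals [q0] at [t0]. *)
have [p [q [fE qn0 qt0]]] : exists p q : jetpoly R,
    [/\ p0%:F / q0%:F = p%:F / q%:F :> K, q != 0 &
        poly_eval idfun (section_jet (frame_jet t0)) q != 0].
  exists (act_poly (frame_mx t0) p0), (act_poly (frame_mx t0) q0); split.
  - exact: (invariant_act_poly (frame_mx_CSp2 t0pos) q00 inv).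
  - exact: act_poly_neq0 (MU _ t0pos) q00.
  - by rewrite eval_act_poly -normalize_jet ?MU ?hess_pos // act_Kinv ?MU.
rewrite fE in inv *; exists p, q.
have val_s r : exists2 rs, rs = poly_eval jc (section_jet J) r &
    forall t, hess_det t != 0 -> value (poly_eval idfun t) rs
      (poly_eval idfun (section_jet (frame_jet t)) r).
  exists (poly_eval jc (section_jet J) r) => // t ht.
  apply: value_poly_eval => [c|z]; first exact: (value_const idfun).
  by apply: value_section_jet => i j; apply: value_frame_jet.
have [ps <- vps] := val_s p; have [qs <- vqs] := val_s q.
have qs0 : qs != 0 := value_neq0 (vqs t0 (hess_pos _ t0pos)) qt0.
split=> //; apply/eqP; rewrite -subr_eq0; apply/eqP.
have [a [b [b0 eab]]] : exists a b : jetpoly R,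
    b != 0 /\ p%:F / q%:F - ps / qs = a%:F / b%:F.
  by elim/frac_ind: (_ - _) => a b b0; exists a, b.
have [n [d [d0 eqs]]] : exists n d : jetpoly R, d != 0 /\ qs = n%:F / d%:F.
  by elim/frac_ind: (qs) => n d d0; exists n, d.
have n0 : n != 0.
  by apply: contraNneq qs0 => e; rewrite eqs e tofrac0 mul0r.
(* With all denominators multiplied in, only jets where each is nonzero matter; there, invariance
   under [invmx (frame_mx t)] compares [t] with its normalized jet. *)
suff a0 : a * (b * (q * (n * d))) = 0.
  rewrite eab; move: a0 => /eqP; rewrite mulf_eq0 => /orP[/eqP ->|].
    by rewrite tofrac0 mul0r.
  by rewrite !mulf_eq0 (negPf b0) (negPf qn0) (negPf n0) (negPf d0).
apply: vanish_positive_frame => t tpos; apply/eqP; apply: contraT.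
move=> /morph_prod_neq0[at0 bt qt ndt].
have ht := hess_pos _ tpos.
have [nt dt] : poly_eval idfun t n != 0 /\ poly_eval idfun t d != 0.
  apply/andP; rewrite -negb_or -mulf_eq0; apply: contraNN ndt => /eqP e.
  by apply/eqP; apply: (etrans (rmorphM _ n d)).
have vqn := has_value_frac n dt; rewrite -eqs in vqn.
have qst0 : poly_eval idfun (section_jet (frame_jet t)) q != 0.
  by rewrite (value_uniq (vqs t ht) vqn) mulf_neq0 ?invr_eq0.
have gG : CSp2 (invmx (frame_mx t)).
  by apply/CSp2P; rewrite det_inv invr_gt0; apply/CSp2P/frame_mx_CSp2.
have sec : jet_act (invmx (frame_mx t)) t = section_jet (frame_jet t).
  by rewrite jet_act_act normalize_jet ?MU.
have := has_value_frac p qst0; rewrite -{1}sec => vsec.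
have e := inv _ _ _ _ gG (has_value_frac p qt) vsec.
have v0 := valueB (has_value_frac p qt) (value_div (vps t ht) (vqs t ht) qst0).
rewrite eab e subrr in v0.
have := value_uniq (has_value_frac a bt) v0 => /eqP.
by rewrite mulf_eq0 invr_eq0 (negPf bt) orbF (negPf at0).
Qed.

End Density.

(** * The formal differential algebra *)

Section RelationTransfer.
Variables (F F' : fieldType) (d1 d2 : F -> F) (d1' d2' : F' -> F').
Variable rv : F -> F' -> Prop.
Hypothesis rvB : forall f g a b, rv f a -> rv g b -> rv (f - g) (a - b).
Hypothesis rvD : forall f g a b, rv f a -> rv g b -> rv (f + g) (a + b).
Hypothesis rvM : forall f g a b, rv f a -> rv g b -> rv (f * g) (a * b).
Hypothesis rvV : forall f a, rv f a -> a != 0 -> rv f^-1 a^-1.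
Hypothesis rv_nat : forall n, rv n%:R n%:R.
Hypothesis rv1 : forall f a, rv f a -> rv (d1 f) (d1' a).
Hypothesis rv2 : forall f a, rv f a -> rv (d2 f) (d2' a).
Variables (y b : F) (y' b' : F').
Hypotheses (rvy : rv y y') (rvb : rv b b').

Let rvN f a : rv f a -> rv (- f) (- a).
Proof. by move=> fa; rewrite -[- f]add0r -[- a]add0r; apply: rvB (rv_nat 0) fa. Qed.

Ltac transfer := repeat first [ done | exact: (rv_nat 1) | exact: rv_nat
  | apply: rv1 | apply: rv2 | apply: rvB | apply: rvN | apply: rvD
  | apply: rvM | apply: rvV ].

Lemma transfer_rel1 : rv (rel1 d2 y) (rel1 d2' y').
Proof. by rewrite /rel1; transfer. Qed.

Lemma transfer_rel2 : rv (rel2 d1 d2 y) (rel2 d1' d2' y').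
Proof. by rewrite /rel2; transfer. Qed.

Hypothesis i10 : d1' y' != 0.

Lemma transfer_rel3 f f' : rv f f' -> rv (rel3 d1 d2 y f) (rel3 d1' d2' y' f').
Proof. by rewrite /rel3 => ff'; transfer. Qed.

Lemma transfer_rel4 : b' != 0 -> 2 != 0 :> F' ->
  rv (rel4 d1 d2 y b) (rel4 d1' d2' y' b').
Proof.
move=> b0 t0.
have den1 : 2 * b' != 0 by rewrite mulf_neq0.
have den2 : 2 * (d1' y' * d1' y') * b' != 0 by rewrite !mulf_neq0.
by rewrite /rel4 !expr2; transfer.
Qed.

Lemma transfer_coef_ga : rv (coef_ga d1 y b) (coef_ga d1' y' b').
Proof. by rewrite /coef_ga; transfer. Qed.

Lemma transfer_coef_de : rv (coef_de d1 d2 y b) (coef_de d1' d2' y' b').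
Proof. by rewrite /coef_de /coef_be; transfer. Qed.

(** Used with [rv] the evaluation of formal symbols and also with [rv] membership of the first
    argument in [loc]. The latter is not closed under inverses, hence the separate premises on
    [coef_ga] and [coef_de]. *)
Lemma transfer_normal_jet i j :
  rv (coef_ga d1 y b) (coef_ga d1' y' b') ->
  rv (coef_de d1 d2 y b) (coef_de d1' d2' y' b') ->
  rv (normal_jet d1 d2 y b i j) (normal_jet d1' d2' y' b' i j).
Proof.
move=> g d.
have fc k : rv (first_col d1 y k) (first_col d1' y' k).
  by elim: k => //= k IHk; transfer.
have sc k : rv (second_col d1 d2 y k) (second_col d1' d2' y' k).
  elim: k => [|[|k] IHk]; [exact: (rv_nat 0) | exact/rvN/(rv_nat 1) |].
  exact: (rvB (rv2 (fc k.+2)) (rvM (rv_nat k.+2) IHk)).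
rewrite /normal_jet; move: i.
suff: (forall i, rv ((two_cols d1 d2 y b j).1 i) ((two_cols d1' d2' y' b' j).1 i)) /\
      (forall i, rv ((two_cols d1 d2 y b j).2 i) ((two_cols d1' d2' y' b' j).2 i)).
  by case.
elim: j => [|j [IH1 IH2]]; first by split.
split=> //; elim=> [|i IHi] /=.
  exact: (rvB (rvB (rv2 (IH2 0%N)) (rv_nat 0))
    (rvM (rv_nat _) (rvD (rvM g (IH1 1%N)) (rvM d (IH2 0%N))))).
exact: (rvB (rvB (rv2 (IH2 _)) (rvM (rv_nat _) IHi))
  (rvM (rv_nat _) (rvD (rvM g (IH1 _)) (rvM d (IH2 _))))).
Qed.

End RelationTransfer.

Section FractionsWithDenominator.
Variables (P : idomainType) (e : P) (e0 : e != 0).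
Local Notation K := {fraction P}.

Definition loc (f : K) : Prop := exists p n, f = p%:F / e%:F ^+ n.

Let eF n : e%:F ^+ n != 0 :> K.
Proof. by rewrite expf_neq0 // tofrac_eq0. Qed.

Lemma loc_tofrac p : loc p%:F.
Proof. by exists p, 0%N; rewrite divr1. Qed.

Lemma loc_add f g : loc f -> loc g -> loc (f + g).
Proof.
move=> [p [n ->]] [q [m ->]]; exists (p * e ^+ m + q * e ^+ n), (n + m)%N.
by rewrite addf_div // exprD tofracD !tofracM !tofracXn.
Qed.

Lemma loc_mul f g : loc f -> loc g -> loc (f * g).
Proof.
move=> [p [n ->]] [q [m ->]]; exists (p * q), (n + m)%N.
by rewrite mulf_div exprD tofracM.
Qed.

Lemma loc_opp f : loc f -> loc (- f).
Proof. by move=> [p [n ->]]; exists (- p), n; rewrite tofracN mulNr. Qed.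

Lemma loc_natr n : loc n%:R.
Proof. by rewrite -(rmorph_nat (@FracField.tofrac P)); apply: loc_tofrac. Qed.

Lemma loc_inv_factor p q : e = p * q -> loc (p%:F)^-1.
Proof.
move=> eE; have [p0 q0] : p%:F != 0 :> K /\ q%:F != 0 :> K.
  by apply/andP; rewrite -negb_or -mulf_eq0 -tofracM -eE tofrac_eq0.
by exists q, 1%N; rewrite expr1 eE tofracM invfM mulrCA mulfV // mulr1.
Qed.

Lemma loc_quotient_rule (D : K -> K) (d : P -> P) :
  (forall p q, q != 0 ->
     D (p%:F / q%:F) = (d p * q - p * d q)%:F / (q ^+ 2)%:F) ->
  forall f, loc f -> loc (D f).
Proof.
move=> DE f [p [n ->]]; rewrite -tofracXn DE ?expf_neq0 //.
by exists (d p * e ^+ n - p * d (e ^+ n)), (n * 2)%N; rewrite -tofracXn exprM.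
Qed.

End FractionsWithDenominator.

Fact tofrac_eq0_inj (P : idomainType) (p : P) : p%:F = 0 :> {fraction P} -> p = 0.
Proof. by move/eqP; rewrite tofrac_eq0 => /eqP. Qed.

Section FormalAlgebra.
Variable R : realType.
Local Notation K := (jetfield R).
Local Notation P := (dpoly R bool bool).
Local Notation L := (dfrac R bool bool).
Local Notation d1 := (@formal_der R bool bool false).
Local Notation d2 := (@formal_der R bool bool true).
Local Notation Y0 := (@formal_gen R bool bool false).
Local Notation Y2b := (@formal_gen R bool bool true).
Local Notation jc := (@jet_const R).
Local Notation th := (jvar R).

Definition formal_const (c : R) : L := (c%:MP : P)%:F.

HB.instance Definition _ := GRing.RMorphism.copy formal_const
  (@FracField.tofrac P \o @mkmalgU {cmonom (bool * seq bool)%type} R mone).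

Lemma d1_derivation : derivation d1. Proof. exact: frac_derivation. Qed.
Lemma d2_derivation : derivation d2. Proof. exact: frac_derivation. Qed.

Lemma formal_der_const j c : formal_der j (formal_const c) = 0.
Proof. exact: frac_der_const. Qed.

Lemma formal_der_var j i w :
  formal_der j (var R (i, w))%:F = (var R (i, j :: w))%:F :> L.
Proof. exact: frac_der_var. Qed.

Definition jet_val : bool * seq bool -> K := fun iw =>
  foldr (pair_fun (@nabla1 R) (@nabla2' R)) (pair_fun (I0 R) (I2b' R) iw.1) iw.2.

Local Notation val := (value (poly_eval jc jet_val)).

Lemma value_formal_const c : val (formal_const c) (jc c).
Proof. by rewrite -(poly_evalC jc jet_val c); apply: value_tofrac. Qed.

Lemma value_var iw : val (var R iw)%:F (jet_val iw).
Proof. by rewrite -(poly_evalX jc jet_val iw); apply: value_tofrac. Qed.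

Lemma value_d1 f c : val f c -> val (d1 f) (nabla1 c).
Proof.
apply: value_frac_der (nabla1_derivation R) _ => p.
apply: eval_poly_der (nabla1_derivation R) _ _ => [a|[i w]].
  exact: nabla1_const.
by rewrite poly_evalX.
Qed.

Lemma value_d2 f c : val f c -> val (d2 f) (nabla2' c).
Proof.
apply: value_frac_der (nabla2_derivation R) _ => p.
apply: eval_poly_der (nabla2_derivation R) _ _ => [a|[i w]].
  exact: nabla2_const.
by rewrite poly_evalX.
Qed.

Lemma value_Y0 : val Y0 (I0 R). Proof. exact: value_var. Qed.
Lemma value_Y2b : val Y2b (I2b' R). Proof. exact: value_var. Qed.

Lemma nabla1_I0_neq0 : nabla1 (I0 R) != 0.
Proof. rewrite -I1_nabla1; exact: euler_det_neq0. Qed.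

Lemma d1Y0 : d1 Y0 = (var R (false, [:: false]))%:F.
Proof. exact: formal_der_var. Qed.

Lemma d1Y0_neq0 : d1 Y0 != 0.
Proof. exact: value_neq0 (value_d1 value_Y0) nabla1_I0_neq0. Qed.

Lemma Y2b_neq0 : Y2b != 0.
Proof. exact: value_neq0 value_Y2b (I2b'_neq0 R). Qed.

Lemma two_neq0_L : 2 != 0 :> L.
Proof. by rewrite -(rmorph_nat formal_const) fmorph_eq0 pnatr_eq0. Qed.

Definition dens_prod : P := var R (false, [:: false]) * var R (true, [::]).

Lemma dens_prodE : dens_prod%:F = d1 Y0 * Y2b.
Proof. by rewrite d1Y0; apply: tofracM. Qed.

Lemma dens_prod_neq0 : dens_prod != 0.
Proof.
have := mulf_neq0 d1Y0_neq0 Y2b_neq0; rewrite -dens_prodE.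
by apply: contra_neq => ->; apply: tofrac0.
Qed.

Local Notation loc := (loc dens_prod).
Local Notation C := (consequence (H_dens R) (@H_relator R)).

Lemma loc_localization f : loc f -> localization (H_dens R) f.
Proof.
move=> [p [n ->]]; exists p, (flatten (nseq n (H_dens R))); split.
  by move=> z /flattenP[s]; rewrite mem_nseq => /andP[_ /eqP->].
congr (_ / _); rewrite dens_prodE; elim: n => [|n IHn]; first by rewrite big_nil.
by rewrite exprS IHn /= !big_cons mulrA.
Qed.

Lemma consequence_ideal : differential_ideal d1 d2 loc C.
Proof.
have lP := loc_localization.
split.
- exact: loc_add dens_prod_neq0.
- exact: loc_mul.
- exact: loc_opp.
- exact: loc_natr.
- by apply: (loc_quotient_rule dens_prod_neq0) => p q; apply: frac_derE.
- by apply: (loc_quotient_rule dens_prod_neq0) => p q; apply: frac_derE.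
- by move=> f g; apply: conseq_add.
- by move=> a f /lP; apply: conseq_mul.
- rewrite -(mul0r (rel1 d2 Y0)); apply: conseq_mul (lP _ (loc_natr _ 0)) _.
  exact/conseq_relator/H_rel1.
- by move=> f; apply: conseq_der.
- by move=> f; apply: conseq_der.
Qed.

Lemma localization_value a : localization (H_dens R) a -> exists c, val a c.
Proof.
move=> [p [s [sH ->]]].
have [c vc c0] : exists2 c, val (\prod_(z <- s) z) c & c != 0.
  elim: s sH => [|z s IHs] sH.
    by exists 1; rewrite ?big_nil ?oner_neq0 //; apply: value1.
  have [|c vc c0] := IHs; first by move=> z' zs; apply: sH; rewrite inE zs orbT.
  have [c' vc' c'0] : exists2 c', val z c' & c' != 0.
    have := sH z (mem_head _ _); rewrite !inE => /orP[]/eqP ->.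
      by exists (nabla1 (I0 R)); [apply: value_d1 value_Y0 | apply: nabla1_I0_neq0].
    by exists (I2b' R); [apply: value_Y2b | apply: I2b'_neq0].
  have vcc : val (\prod_(x <- z :: s) x) (c' * c).
    by rewrite big_cons; exact: (valueM vc' vc).
  exact: (ex_intro2 _ _ _ vcc (mulf_neq0 c'0 c0)).
by eexists; apply: value_div (value_tofrac _ p) vc c0.
Qed.

(** Soundness, by induction on the generation of [r]. Both [rel3] at [f] and multiplication by [a]
    require these elements to have values; they do because I_1 and I'_2b are nonzero jet
    functions. *)
Lemma consequence_value r : C r -> val r 0.
Proof.
have vB := @valueB _ _ (poly_eval jc jet_val).
have vD := @valueD _ _ (poly_eval jc jet_val).
have vM := @valueM _ _ (poly_eval jc jet_val).
have vV := @valueV _ _ (poly_eval jc jet_val).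
have vn := @value_nat _ _ (poly_eval jc jet_val).
have [r1 r2 r3 r4] := jet_relations R.
have tn := two_neq0 R; have bn := I2b'_neq0 R; have yn := nabla1_I0_neq0.
have [v1 v2] := (value_d1, value_d2).
elim=> {r} [r [||f /localization_value[c fc]|]|r r' _ IH _ IH'|a r la _ IH|j r _ IH].
- exact: (eq_ind _ (val _) (transfer_rel1 v2 value_Y0) _ r1).
- exact: (eq_ind _ (val _) (transfer_rel2 vB vn v1 v2 value_Y0) _ r2).
- exact: (eq_ind _ (val _)
    (transfer_rel3 vB vD vM vV vn v1 v2 value_Y0 yn fc) _ (r3 c)).
- exact: (eq_ind _ (val _)
    (transfer_rel4 vB vD vM vV vn v1 v2 value_Y0 value_Y2b yn bn tn) _ r4).
- by rewrite -[0]addr0; apply: vD.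
- by have [c ac] := localization_value la; rewrite -(mulr0 c); apply: vM.
- case: j; first by rewrite -(der0 (nabla2_derivation R)); apply: v2.
  by rewrite -(der0 (nabla1_derivation R)); apply: v1.
Qed.

Local Notation Jh := (normal_jet d1 d2 Y0 Y2b).
Local Notation al := (coef_al d1 Y0).

Lemma value_al : val al (coef_al (@nabla1 R) (I0 R)).
Proof. exact: (valueV (value_d1 value_Y0) nabla1_I0_neq0). Qed.

Lemma value_Jh i j : val (Jh i j) (frame_jet th i j).
Proof.
have vB := @valueB _ _ (poly_eval jc jet_val).
have vD := @valueD _ _ (poly_eval jc jet_val).
have vM := @valueM _ _ (poly_eval jc jet_val).
have vV := @valueV _ _ (poly_eval jc jet_val).
have vn := @value_nat _ _ (poly_eval jc jet_val).
have yn := nabla1_I0_neq0; have [v1 v2] := (value_d1, value_d2).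
rewrite frame_jet_normal_jet.
apply: (transfer_normal_jet vB vD vM vn v1 v2 value_Y0).
  exact: (transfer_coef_ga vB vM vV vn v1 value_Y0 value_Y2b yn).
exact: (transfer_coef_de vB vD vM vV vn v1 v2 value_Y0 value_Y2b yn).
Qed.

Local Notation be := (coef_be d1 d2 Y0).
Local Notation ga := (coef_ga d1 Y0 Y2b).
Local Notation de := (coef_de d1 d2 Y0 Y2b).

Let cP := consequence_ideal.

Lemma loc_Y0 : loc Y0. Proof. exact: loc_tofrac. Qed.
Lemma loc_Y2b : loc Y2b. Proof. exact: loc_tofrac. Qed.

Lemma loc_coef_al : loc al.
Proof.
rewrite /coef_al d1Y0.
exact: (@loc_inv_factor _ _ dens_prod_neq0 _ (var R (true, [::])) erefl).
Qed.

Fact loc_coefs (F : fieldType) (e1 e2 : F -> F) (lo ideal : F -> Prop)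
    (dP : differential_ideal e1 e2 lo ideal) (y b : F) :
  lo y -> lo b -> lo (e1 y)^-1 ->
  [/\ lo (coef_be e1 e2 y), lo (coef_ga e1 y b) & lo (coef_de e1 e2 y b)].
Proof.
move=> ly lb lr; have l1 := loc_d1 dP; have l2 := loc_d2 dP.
have lD := locD dP; have lM := locM dP; have lN := locN dP; have ln := loc_nat dP.
have ls : lo (e1 (e1 y) - e1 y) := lD _ _ (l1 _ (l1 _ ly)) (lN _ (l1 _ ly)).
have lbe : lo (coef_be e1 e2 y).
  exact: (lD _ _ (lD _ _ (l2 _ ls) (ln 1%N)) (lM _ _ ls lr)).
split=> //; first exact: (lN _ (lM _ _ lb lr)).
exact: (lD _ _ (lD _ _ (lD _ _ (lD _ _ (l1 _ lb) (lM _ _ (ln 2) lr))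
  (lN _ (lM _ _ (lM _ _ (ln 2) lbe) lb))) lb) (lN _ (lM _ _ (lM _ _ lb ls) lr))).
Qed.

Lemma loc_be_ga_de : [/\ loc be, loc ga & loc de].
Proof. exact: (loc_coefs cP loc_Y0 loc_Y2b loc_coef_al). Qed.

Lemma loc_Jh i j : loc (Jh i j).
Proof.
have [_ lga lde] := loc_be_ga_de.
apply: (@transfer_normal_jet L L d1 d2 d1 d2 (fun f _ => loc f)) => //.
- by move=> f g _ _; apply: (locB cP).
- by move=> f g _ _; apply: (locD cP).
- by move=> f g _ _; apply: (locM cP).
- exact: (loc_nat cP).
- by move=> f _; apply: (loc_d1 cP).
- by move=> f _; apply: (loc_d2 cP).
- exact: Y0.
- exact: Y2b.
- exact: loc_Y0.
Qed.

Lemma conseq_err2 i j : C (err2 d2 ga de Jh i j).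
Proof.
rewrite err2_normal_jet.
case: ifP => _; first exact/conseq_relator/H_rel1.
case: ifP => _; first exact/conseq_relator/H_rel2.
exact: (ideal0 cP).
Qed.

Lemma conseq_err1 i j : C (err1 d1 al be Jh i j).
Proof.
have [lbe lga lde] := loc_be_ga_de; have lal := loc_coef_al.
have ls : loc (d1 (d1 Y0) - d1 Y0).
  exact: (locB cP (loc_d1 cP (loc_d1 cP loc_Y0)) (loc_d1 cP loc_Y0)).
have R2 : C (rel2 d1 d2 Y0) by apply/conseq_relator/H_rel2.
have R3 f : loc f -> C (rel3 d1 d2 Y0 f).
  by move=> lf; apply/conseq_relator/H_rel3/loc_localization.
have R4 : C (rel4 d1 d2 Y0 Y2b) by apply/conseq_relator/H_rel4.
have lV2 : loc (d1 Y0 ^+ 2)^-1.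
  by rewrite expr2 invfM; exact: (locM cP lal lal).
have lb2 : loc (- 2 * Y2b).
  exact: (locM cP (locN cP (loc_nat cP 2)) loc_Y2b).
apply: (err1_in_ideal d1_derivation d2_derivation cP lal lbe lga lde loc_Jh).
- by move=> f lf; rewrite comm_errE; apply: R3.
- rewrite (curv1E d1_derivation d2_derivation Y2b d1Y0_neq0) mulrC.
  exact: (idealM cP lV2 R2).
- rewrite (curv2E d1_derivation d2_derivation d1Y0_neq0 Y2b_neq0 two_neq0_L).
  exact: (idealB cP (idealD cP (idealM cP lb2 R4) (idealM cP (locM cP ls lV2) R2))
    (idealM cP (locM cP (loc_nat cP 2) loc_Y2b) (R3 _ ls))).
- exact: conseq_err2.
- by move=> k; rewrite err1_normal_jet0; apply: (ideal0 cP).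
Qed.

Local Notation nf := (normal_form formal_const al Jh).
Local Notation red := (reducible loc C formal_const al Jh).

Lemma nf_coefs : [/\ nf be, nf ga & nf de].
Proof.
have r0 := d1Y0_neq0.
have J i j : nf (Jh i j) by exact: nf_J.
have a : nf al by exact: nf_al.
split.
- exact: (eq_ind_r nf (nfD (nfB (J 2 1) (nf_nat _ _ _ 1)) (nfM (J 2 0) a))
    (coef_beE d1 d2 Y0 Y2b)).
- exact: (eq_ind_r nf (nfN (nfM (J 0 2) a)) (coef_gaE d2_derivation Y2b r0)).
- exact: (eq_ind_r nf (nfB (nfD (J 1 2) (J 0 2)) (nfM (nfM (J 0 2) (J 2 0)) a))
    (coef_deE d2_derivation Y2b r0)).
Qed.

Lemma red_d1 f : red f -> red (d1 f).
Proof.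
have [nbe nga nde] := nf_coefs.
have J i j : nf (Jh i j) by exact: nf_J.
have a : nf al by exact: nf_al.
have n k : nf k%:R by exact: nf_nat.
apply: (reducible_der cP _ loc_coef_al loc_Jh d1_derivation) => [c|||c||i j].
- exact: loc_tofrac.
- exact: (loc_d1 cP).
- exact: (ideal_d1 cP).
- exact: formal_der_const.
- rewrite (d1_coef_al d2 d1_derivation Y0 Y2b).
  apply: (nf_reducible cP) => [c|||]; [exact: loc_tofrac|exact: loc_coef_al|exact: loc_Jh|].
  exact: (nfN (nfM (nfD (J 2 0) (J 1 0)) (nfM a a))).
- split; first exact/(loc_d1 cP)/loc_Jh.
  exists (Jh i.+1 j + i%:R * Jh i j + j%:R * (al * Jh i.+1 j.-1 + be * Jh i j)).
    exact: (nfD (nfD (J _ _) (nfM (n i) (J _ _)))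
      (nfM (n j) (nfD (nfM a (J _ _)) (nfM nbe (J _ _))))).
  exact: conseq_err1.
Qed.

Lemma red_d2 f : red f -> red (d2 f).
Proof.
have [nbe nga nde] := nf_coefs.
have J i j : nf (Jh i j) by exact: nf_J.
have a : nf al by exact: nf_al.
have n k : nf k%:R by exact: nf_nat.
apply: (reducible_der cP _ loc_coef_al loc_Jh d2_derivation) => [c|||c||i j].
- exact: loc_tofrac.
- exact: (loc_d2 cP).
- exact: (ideal_d2 cP).
- exact: formal_der_const.
- split; first exact/(loc_d2 cP)/loc_coef_al.
  exists (al * al); first exact: (nfM a a).
  rewrite (d2_coef_al d1 d2_derivation).
  apply: (idealM cP); last exact/conseq_relator/H_rel2.
  by apply/(locN cP)/(locM cP); exact: loc_coef_al.
- split; first exact/(loc_d2 cP)/loc_Jh.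
  exists (Jh i j.+1 + i%:R * Jh i.-1 j.+1 + j%:R * (ga * Jh i.+1 j.-1 + de * Jh i j)).
    exact: (nfD (nfD (J _ _) (nfM (n i) (J _ _)))
      (nfM (n j) (nfD (nfM nga (J _ _)) (nfM nde (J _ _))))).
  exact: conseq_err2.
Qed.

Lemma red_nf f : nf f -> red f.
Proof.
apply: (nf_reducible cP) => [c||]; [exact: loc_tofrac|exact: loc_coef_al|exact: loc_Jh].
Qed.

Lemma red_var iw : red (var R iw)%:F.
Proof.
case: iw => i w; elim: w => [|j w IHw]; last first.
  by rewrite -formal_der_var; case: j; [apply: red_d2 | apply: red_d1].
case: i.
  have -> : (var R (true, [::]))%:F = Jh 0 2 :> L.
    by rewrite (normal_jet02 d2_derivation Y2b d1Y0_neq0).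
  exact/red_nf/nf_J.
exact/red_nf/(nf_J _ _ _ 0 0).
Qed.

Lemma red_poly (p : P) : red p%:F.
Proof.
have lJ := loc_Jh; have la := loc_coef_al.
have lc c : loc (formal_const c) by exact: loc_tofrac.
elim/ipoly_ind: p => [c|iw|p q IHp IHq|p q IHp IHq].
- exact/red_nf/nf_const.
- exact: red_var.
- exact: (eq_ind _ red (reducibleD cP IHp IHq) _ (esym (tofracD p q))).
- exact: (eq_ind _ red (reducibleM cP lc la lJ IHp IHq) _ (esym (tofracM p q))).
Qed.

(* The functions J_ij are independent, so the normal form of a relation is 0. *)
Lemma relation_consequence (p : P) : poly_eval jc jet_val p = 0 -> C p%:F.
Proof.
move=> p0; have [_ [g ng cpg]] := red_poly p.
have e : al * Jh 1 0 = 1.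
  rewrite (normal_jet10 _ _ _ Y2b); exact: (mulVf d1Y0_neq0).
suff g0 : g = 0 by rewrite g0 subr0 in cpg.
have vg : val g 0.
  have vp : val p%:F 0 := eq_ind _ (val _) (value_tofrac _ p) _ p0.
  by have := valueB vp (consequence_value cpg); rewrite subKr subr0.
have [q [n gE]] := nf_poly_eval e ng.
have vq : val (poly_eval formal_const (section_jet Jh) q)
    (poly_eval jc (section_jet (frame_jet th)) q).
  apply: value_poly_eval => [c|z]; first exact: value_formal_const.
  by apply: value_section_jet; apply: value_Jh.
(* The power of [al] evaluates to a power of I_1^-1, which is nonzero, so [q] itself vanishes at the
   J_ij. *)
have q0 : poly_eval jc (section_jet (frame_jet th)) q = 0.
  have := valueM vq (valueXn n value_al); rewrite -gE => /(value_uniq vg)/esym/eqP.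
  rewrite mulf_eq0 => /orP[/eqP //|].
  by rewrite expf_eq0 invr_eq0 (negPf nabla1_I0_neq0) andbF.
have {}q0 := frame_jet_independent q0.
pose C0 := @mkmalgU {cmonom jetvar} R mone.
(* Independence kills [q] only after u_y and u_xy are replaced by 0 and -1. The formal [Jh 0 1] and
   [Jh 1 1] are these constants by definition, so the replacement does not change the evaluation of
   [q] at the [Jh i j]. *)
pose sigma := section_eval (fun z => var R z : jetpoly R).
have sigmaF z : (sigma z)%:F = section_eval th z.
  case: z => [||[|[|i]] [|[|j]]]; [exact: tofrac1 | exact: tofrac0
    | exact: erefl | exact: tofrac0 | exact: erefl | exact: erefl
    | exact: rmorphN1 | exact: erefl ..].
have s0 : poly_eval C0 sigma q = 0 :> jetpoly R.
  have e0 : (poly_eval C0 sigma q : jetpoly R)%:F = poly_eval jc (fun z => (sigma z)%:F) q.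
    exact: (poly_eval_comp (h := @FracField.tofrac (jetpoly R)) (iota' := jc)
      sigma q (fun=> erefl)).
  exact: (tofrac_eq0_inj (etrans e0 (etrans (poly_eval_ext jc q sigmaF) q0))).
pose h := poly_eval formal_const (section_jet Jh).
have hs z : h (sigma z) = section_jet Jh z.
  case: z => [||[|[|i]] [|[|j]]]; [exact: rmorph1 | exact: rmorph0
    | exact: poly_evalX | exact: rmorph0 | exact: poly_evalX | exact: poly_evalX
    | exact: rmorphN1 | exact: poly_evalX ..].
have h0 : h q = 0.
  apply: (etrans (esym (poly_eval_ext formal_const q hs))).
  apply: (etrans (esym (poly_eval_comp (iota := C0) (iota' := formal_const) sigma q
    (fun c => poly_evalC formal_const (section_jet Jh) c)))).
  exact: (etrans (congr1 h s0) (rmorph0 _)).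
by rewrite gE -/h h0 mul0r.
Qed.

(** The corresponding formal quotient has this element as its value, and a value is by definition a
    quotient of evaluations of two differential polynomials; this gives generation by I_0 and
    I'_2b. *)
Lemma frame_rational (p q : jetpoly R) :
  poly_eval jc (section_jet (frame_jet th)) q != 0 ->
  exists a c : P, poly_eval jc jet_val c != 0 /\
    poly_eval jc (section_jet (frame_jet th)) p /
    poly_eval jc (section_jet (frame_jet th)) q =
    poly_eval jc jet_val a / poly_eval jc jet_val c.
Proof.
move=> q0.
have v r : val (poly_eval formal_const (section_jet Jh) r)
    (poly_eval jc (section_jet (frame_jet th)) r).
  apply: value_poly_eval => [c|z]; first exact: value_formal_const.
  by apply: value_section_jet; apply: value_Jh.
have [a [c [_ c0 e]]] := value_div (v p) (v q) q0.
by exists a, c.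
Qed.

Lemma jet_val_fixed g : g \in unitmx -> forall iw, pullback g (jet_val iw) = jet_val iw.
Proof.
move=> gU [i w]; elim: w => [|j w IHw].
  case: i; last exact: (pullback_frame_jet gU 0 0).
  rewrite /jet_val /= -frame_jet02E; exact: pullback_frame_jet.
have E : jet_val (i, j :: w) = pair_fun (@nabla1 R) (@nabla2' R) j (jet_val (i, w)) by [].
rewrite E; case: j {E} => /=.
  exact: (etrans (pullback_nabla2 gU _) (congr1 _ IHw)).
exact: (etrans (pullback_nabla1 gU _) (congr1 _ IHw)).
Qed.

Lemma jet_presentation :
  presented jc (pair_fun (I0 R) (I2b' R)) (pair_fun (@nabla1 R) (@nabla2' R))
    (@differential_invariant R) (H_dens R) (@H_relator R).
Proof.
split=> [f|p]; last first.
  split; first exact: relation_consequence.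
  move=> /consequence_value v0.
  exact: (value_uniq (value_tofrac (poly_eval jc jet_val) p) v0).
split=> [/invariant_on_section[p [q [q0 ->]]]|[p [q [q0 ->]]]].
  exact: frame_rational.
apply: pullback_fixed_invariant => g gU.
apply: (pullback_div gU q0).
  exact: (pullback_poly_eval gU p (jet_val_fixed gU)).
exact: (pullback_poly_eval gU q (jet_val_fixed gU)).
Qed.

End FormalAlgebra.

Theorem mainTheorem9 (R : realType) :
  [/\ I1 R = nabla1 (I0 R),
      I2a R = nabla1 (I1 R) - I1 R,
      invariant_derivation (@nabla1 R) &
      invariant_derivation (@nabla2' R)] /\
  [/\ rel1 (@nabla2' R) (I0 R) = 0,
      rel2 (@nabla1 R) (@nabla2' R) (I0 R) = 0,
      (forall f, rel3 (@nabla1 R) (@nabla2' R) (I0 R) f = 0) &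
      rel4 (@nabla1 R) (@nabla2' R) (I0 R) (I2b' R) = 0] /\
  presented (@jet_const R)
    (pair_fun (I0 R) (I2b' R)) (pair_fun (@nabla1 R) (@nabla2' R))
    (@differential_invariant R) (H_dens R) (@H_relator R).
Proof.
split; [|split].
- split; [exact: I1_nabla1 | exact: I2a_nabla1 | exact: nabla1_invariant
    | exact: nabla2_invariant].
- exact: jet_relations.
- exact: jet_presentation.
Qed.
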